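(* Let $\Omega\subset\mathbb{R}^n$ be a bounded open set with $C^2$ boundary, $m_0\in\mathcal{P}(\overline\Omega)$, $L$ satisfying (L1)–(L3) below, and $F,G:\overline\Omega\times\mathcal{P}(\overline\Omega)\to\mathbb{R}$ continuous. Suppose that $F$ and $G$ are strictly monotone. Let $\eta_1,\eta_2\in\mathcal{P}_{m_0}(\Gamma)$ be constrained MFG equilibria for $m_0$. Then $J_{\eta_1}=J_{\eta_2}$. Consequently, if $(u_1,m_1)$ and $(u_2,m_2)$ are mild solutions of the constrained MFG problem in $\overline\Omega$, then $u_1=u_2$.
   Context: (L1) $L\in C^1(\overline\Omega\times\mathbb{R}^n)$, $|D_xL(x,v)|\le C(1+|v|^2)$, $|D_vL(x,v)|\le C(1+|v|)$; (L2) $L(x,v)\ge c_1|v|^2-c_0$ with $c_1,c_0>0$; (L3) $v\mapsto L(x,v)$ convex. $\mathcal{P}(\overline\Omega)$ has the Kantorovich–Rubinstein distance. A function $H:\overline\Omega\times\mathcal{P}(\overline\Omega)\to\mathbb{R}$ is strictly monotone if $\int_{\overline\Omega}(H(x,\mu_1)-H(x,\mu_2))\,d(\mu_1-\mu_2)(x)\ge0$ for all $\mu_1,\mu_2\in\mathcal{P}(\overline\Omega)$, with equality if and only if $H(x,\mu_1)=H(x,\mu_2)$ for all $x\in\overline\Omega$. $\Gamma=\{\gamma\in AC(0,T;\mathbb{R}^n):\gamma(t)\in\overline\Omega\ \forall t\}$ (uniform metric), $\Gamma[x]=\{\gamma\in\Gamma:\gamma(0)=x\}$, $e_t(\gamma)=\gamma(t)$,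 $\mathcal{P}_{m_0}(\Gamma)=\{\eta: e_0\sharp\eta=m_0\}$, $m^\eta(t)=e_t\sharp\eta$, $J_\eta[\gamma]=\int_0^T[L(\gamma,\dot\gamma)+F(\gamma(t),m^\eta(t))]dt+G(\gamma(T),m^\eta(T))$ for $\gamma\in\Gamma$, $\Gamma^\eta[x]$ = minimizers of $J_\eta$ on $\Gamma[x]$. A constrained MFG equilibrium for $m_0$ is $\eta\in\mathcal{P}_{m_0}(\Gamma)$ with $\mathrm{supp}(\eta)\subseteq\bigcup_x\Gamma^\eta[x]$. A mild solution of the constrained MFG problem in $\overline\Omega$ is a pair $(u,m)\in C([0,T]\times\overline\Omega)\times C([0,T];\mathcal{P}(\overline\Omega))$ such that for some constrained MFG equilibrium $\eta$ for $m_0$, $m(t)=e_t\sharp\eta$ for all $t$ and $u(t,x)=\inf\{\int_t^T[L(\gamma(s),\dot\gamma(s))+F(\gamma(s),m(s))]ds+G(\gamma(T),m(T)):\gamma\in\Gamma,\gamma(t)=x\}$. *)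

(* Defs.v *)
From HB Require Import structures.
From mathcomp Require Import all_boot all_order all_algebra.
From mathcomp Require Import all_classical all_reals all_analysis.
Set Implicit Arguments. Unset Strict Implicit. Unset Printing Implicit Defensive.
Import Order.TTheory GRing.Theory Num.Theory.
Import numFieldNormedType.Exports.
Local Open Scope classical_set_scope.
Local Open Scope ring_scope.

Section MFG.
Variables (R : realType) (n : nat).
Local Notation V := 'rV[R]_n.

Definition borelRn : measurableType _ := g_sigma_algebraType (@open V).

Definition ei (i : 'I_n) : V := delta_mx 0 i.

Definition C2_on (U : set V) (f : V -> R) : Prop :=
  (forall x, U x -> {for x, continuous f}) /\
  (forall x i, U x -> derivable f x (ei i)) /\
  (forall x i, U x -> {for x, continuous (fun y => 'D_(ei i) f y)}) /\
  (forall x i j, U x -> derivable (fun y => 'D_(ei i) f y) x (ei j)) /\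
  (forall x i j, U x ->
     {for x, continuous (fun y => 'D_(ei j) (fun z => 'D_(ei i) f z) y)}).

Definition C2_boundary (Om : set V) : Prop :=
  forall x0, closure Om x0 -> ~ Om x0 ->
  exists2 r : R, 0 < r &
  exists rho : V -> R,
    [/\ C2_on (ball x0 r) rho,
        (forall x, ball x0 r x -> (Om x <-> rho x < 0)) &
        (forall x, ball x0 r x -> closure Om x -> ~ Om x ->
           exists i, 'D_(ei i) rho x != 0)].

Definition Pbar (Om : set V) (mu : probability borelRn R) : Prop :=
  mu (~` closure Om) = 0%E.

Definition Lip1 (Om : set V) (phi : V -> R) : Prop :=
  forall x y, closure Om x -> closure Om y -> `|phi x - phi y| <= `|x - y|.

Definition KR (Om : set V) (mu nu : probability borelRn R) : \bar R :=
  ereal_sup [set (\int[mu]_(x in closure Om) (phi x)%:E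
                 - \int[nu]_(x in closure Om) (phi x)%:E)%E
            | phi in Lip1 Om].

Definition cont_OmP (Om : set V) (H : V -> probability borelRn R -> R) : Prop :=
  forall x mu, closure Om x -> Pbar Om mu ->
  forall e : R, 0 < e -> exists2 d : R, 0 < d &
    forall y nu, closure Om y -> Pbar Om nu ->
      `|y - x| < d -> (KR Om mu nu < d%:E)%E -> `|H y nu - H x mu| < e.

Definition strictly_monotone (Om : set V) (H : V -> probability borelRn R -> R)
  : Prop :=
  forall mu1 mu2, Pbar Om mu1 -> Pbar Om mu2 ->
    let I := (\int[mu1]_(x in closure Om) (H x mu1 - H x mu2)%:E
              - \int[mu2]_(x in closure Om) (H x mu1 - H x mu2)%:E)%E in
    (0 <= I)%E /\
    (I = 0%E <-> forall x, closure Om x -> H x mu1 = H x mu2).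

Definition cont_OmV (Om : set V) (f : V -> V -> R) : Prop :=
  forall x v, closure Om x -> forall e : R, 0 < e -> exists2 d : R, 0 < d &
    forall y w, closure Om y -> `|y - x| < d -> `|w - v| < d ->
      `|f y w - f x v| < e.

(* (L1): L in C^1(Omega-bar x R^n) (C^1 in the interior, with L and its
   partial derivatives extending continuously to Omega-bar x R^n), with the
   growth bounds on D_x L and D_v L. *)
Definition L1 (Om : set V) (L : V -> V -> R) : Prop :=
  exists Lx Lv : 'I_n -> V -> V -> R,
  [/\ forall x v i, Om x ->
        derivable (fun y => L y v) x (ei i) /\
        'D_(ei i) (fun y => L y v) x = Lx i x v,
      forall x v i, Om x ->
        derivable (L x) v (ei i) /\ 'D_(ei i) (L x) v = Lv i x v,
      cont_OmV Om L,
      forall i, cont_OmV Om (Lx i) /\ cont_OmV Om (Lv i) &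
      exists C : R, forall x v, closure Om x ->
        `|(\row_i Lx i x v : V)| <= C * (1 + `|v| ^+ 2) /\
        `|(\row_i Lv i x v : V)| <= C * (1 + `|v|)].

Definition L2 (Om : set V) (L : V -> V -> R) : Prop :=
  exists c1 c0 : R, [/\ 0 < c1, 0 < c0 &
    forall x v, closure Om x -> L x v >= c1 * `|v| ^+ 2 - c0].

Definition L3 (Om : set V) (L : V -> V -> R) : Prop :=
  forall x, closure Om x -> forall v w (l : R), 0 <= l <= 1 ->
    L x (l *: v + (1 - l) *: w) <= l * L x v + (1 - l) * L x w.

Definition AC (T : R) (g : R -> V) : Prop :=
  forall e : R, 0 < e -> exists2 d : R, 0 < d &
    forall (k : nat) (a b : 'I_k -> R),
      (forall i, 0 <= a i /\ a i <= b i /\ b i <= T) ->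
      (forall i j, i != j -> b i <= a j \/ b j <= a i) ->
      \sum_(i < k) (b i - a i) < d ->
      \sum_(i < k) `|g (b i) - g (a i)| < e.

Definition Gamma (T : R) (Om : set V) : set (R -> V) :=
  [set g | AC T g /\ forall t, 0 <= t <= T -> closure Om (g t)].

Definition unif_open (T : R) : set (set (R -> V)) := fun U =>
  forall g, U g -> exists2 e : R, 0 < e &
    forall h, (forall t, 0 <= t <= T -> `|h t - g t| <= e) -> U h.

Definition cspace (T : R) : measurableType _ :=
  g_sigma_algebraType (unif_open T).

Definition on_Gamma (T : R) (Om : set V) (eta : probability (cspace T) R)
  : Prop :=
  exists B : set (cspace T), [/\ measurable B, B `<=` Gamma T Om & eta B = 1%E].

Definition P_m0 (T : R) (Om : set V) (m0 : probability borelRn R)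
  (eta : probability (cspace T) R) : Prop :=
  on_Gamma Om eta /\
  forall A : set borelRn, measurable A -> m0 A = eta [set g | A (g 0)].

Definition is_flow (T : R) (eta : probability (cspace T) R)
  (m : R -> probability borelRn R) : Prop :=
  forall t, 0 <= t <= T ->
  forall A : set borelRn, measurable A -> m t A = eta [set g | A (g t)].

Definition supp (T : R) (Om : set V) (eta : probability (cspace T) R)
  : set (R -> V) :=
  [set g | Gamma T Om g /\ forall e : R, 0 < e ->
     (0 < eta [set h | forall t, (0 <= t <= T)%R -> (`|h t - g t| <= e)%R])%E].

Definition cost (T : R) (L : V -> V -> R) (F G : V -> probability borelRn R -> R)
  (m : R -> probability borelRn R) (t0 : R) (g : R -> V) : \bar R :=
  (\int[lebesgue_measure]_(s in `[t0, T]) (L (g s) (derive1 g s) + F (g s) (m s))%:E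
   + (G (g T) (m T))%:E)%E.

(* J_eta, where m = m^eta *)
Definition J (T : R) L F G m (g : R -> V) : \bar R := cost T L F G m 0 g.

Definition MFG_equilibrium (T : R) (Om : set V) L F G (m0 : probability borelRn R)
  (eta : probability (cspace T) R) : Prop :=
  P_m0 Om m0 eta /\
  exists m, is_flow eta m /\
    forall g, supp Om eta g ->
      forall h, Gamma T Om h -> h 0 = g 0 -> (J T L F G m g <= J T L F G m h)%E.

Definition mild_solution (T : R) (Om : set V) L F G (m0 : probability borelRn R)
  (u : R -> V -> R) (m : R -> probability borelRn R) : Prop :=
  [/\
      forall t x, 0 <= t <= T -> closure Om x ->
        forall e : R, 0 < e -> exists2 d : R, 0 < d &
          forall s y, 0 <= s <= T -> closure Om y -> `|s - t| < d ->
            `|y - x| < d -> `|u s y - u t x| < e,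
      (forall t, 0 <= t <= T -> Pbar Om (m t)) /\
      (forall t, 0 <= t <= T -> forall e : R, 0 < e -> exists2 d : R, 0 < d &
          forall s, 0 <= s <= T -> `|s - t| < d -> (KR Om (m t) (m s) < e%:E)%E),
      exists2 eta : probability (cspace T) R, MFG_equilibrium Om L F G m0 eta & is_flow eta m &
      forall t x, 0 <= t <= T -> closure Om x ->
        (u t x)%:E = ereal_inf [set cost T L F G m t g
                               | g in [set g | Gamma T Om g /\ g t = x]]].

End MFG.

(* Main.v *)
(** Let [Phi_m g] be the part of the cost of the path [g] that depends on the
    flow [m]: the time integral of [F (g s) (m s)] plus [G (g T) (m T)].  If
    [g1] and [g2] are optimal for [eta1] and [eta2] and start at the same point,
    adding the two optimality inequalities cancels the (finite) Lagrangian terms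
    and gives [D g1 <= D g2] for the gap [D := Phi_m1 - Phi_m2].  As [eta1] and
    [eta2] have the same initial marginal, the integral of [D] is at most as
    large under [eta1] as under [eta2].  No measurable selection is needed for
    this: by inner regularity [{D > s}] is exhausted by compact sets of paths,
    whose sets of starting points are closed, so the tails of [D] can be
    compared directly.  By Fubini's theorem the difference of the two integrals
    is the sum of the monotonicity integrals of [F] (integrated in time) and of
    [G], which are nonnegative, hence all vanish.  Strict monotonicity then
    gives [F x (m1 s) = F x (m2 s)] for almost every [s], hence for every [s] by
    continuity of the flows for the Kantorovich-Rubinstein distance, and
    [G x (m1 T) = G x (m2 T)]. *)

Require Import Defs.
From HB Require Import structures.
From mathcomp Require Import all_boot all_order all_algebra.
From mathcomp Require Import all_classical all_reals all_analysis.
From mathcomp Require Import measurable_realfun lra.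
Set Implicit Arguments. Unset Strict Implicit. Unset Printing Implicit Defensive.
Import Order.TTheory GRing.Theory Num.Theory.
Import numFieldNormedType.Exports.
Local Open Scope classical_set_scope.
Local Open Scope ring_scope.

(** * Inner regularity by closed sets *)

(** Continuity from above along the decreasing sets [D N], whose intersection is the remainder left
    by the whole union. It serves throughout to replace countable unions by finite ones. *)
Lemma probability_tail_lt d (T : measurableType d) (R : realType)
    (mu : probability T R) (A : set T) (C : (set T)^nat) (e : R) :
  measurable A -> (forall i, measurable (C i)) ->
  (mu (A `\` \bigcup_i C i) < e%:E)%E ->
  exists N, (mu (A `\` \big[setU/set0]_(i < N) C i) < e%:E)%E.
Proof.
move=> mA mC h.
pose D N := A `\` \big[setU/set0]_(i < N) C i.
have mD N : measurable (D N) by apply: measurableD => //; exact: bigsetU_measurable.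
have DE : \bigcap_N D N = A `\` \bigcup_i C i.
  apply/seteqP; split => [x h1|x [Ux nC] N _].
    split; first by have [] := h1 0%N I.
    move=> [i _ Ci]; have [_] := h1 i.+1 I; apply.
    by rewrite -bigcup_mkord; exists i => //=.
  by split => //; rewrite -bigcup_mkord => -[i _ Ci]; apply: nC; exists i.
have : mu \o D @ \oo --> mu (\bigcap_N D N).
  apply: nonincreasing_cvg_mu => //.
  - by rewrite (le_lt_trans (probability_le1 _ _)) ?ltry.
  - exact: bigcap_measurable.
  - move=> a b ab; apply/subsetPset; apply: setDS; rewrite -!bigcup_mkord.
    by apply: bigcup_sub => i /= ia x Cx; exists i => //=; exact: leq_trans ab.
rewrite DE => cv.
have : nbhs (mu (A `\` \bigcup_i C i)) [set x | (x < e%:E)%E].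
  by apply: open_nbhs_nbhs; split => //; exact: open_ereal_lt_ereal.
by move=> /cv[N _ /(_ N (leqnn N)) /= ?]; exists N.
Qed.

Section closed_inner_regularity.
Context (R : realType) (X : pointedType) (O : set (set X)).
Variable mu : probability (g_sigma_algebraType O) R.
Hypothesis O0 : O set0.
Hypothesis OT : O setT.
Hypothesis OI : forall A B, O A -> O B -> O (A `&` B).
Hypothesis Obigcup : forall A : (set X)^nat, (forall i, O (A i)) -> O (\bigcup_i A i).
Hypothesis Ofsigma : forall U, O U ->
  exists2 C : (set X)^nat, (forall i, O (~` C i)) & U = \bigcup_i C i.

Let mO U : O U -> measurable (U : set (g_sigma_algebraType O)).
Proof. by move=> OU; exact: sub_sigma_algebra. Qed.

Let mOC C : O (~` C) -> measurable (C : set (g_sigma_algebraType O)).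
Proof. by move=> OC; rewrite -(setCK C); apply: measurableC; exact: mO. Qed.

Let OCbigsetU (C : (set X)^nat) N : (forall i, O (~` C i)) ->
  O (~` \big[setU/set0]_(i < N) C i).
Proof.
move=> OC; elim: N => [|N IH]; first by rewrite big_ord0 setC0.
by rewrite big_ord_recr/= setCU; exact: OI.
Qed.

Let approximable : set (set X) := [set A | forall e : R, 0 < e -> exists C U,
  [/\ O (~` C), O U, C `<=` A, A `<=` U & (mu (U `\` C) < e%:E)%E]].

(** Complementation exchanges the closed and the open approximant. For a countable union the gaps
    are summed geometrically; the open sets may all be united, but only finitely many closed ones,
    at the cost of a small tail. *)
Let approximable_sigma_algebra : sigma_algebra setT approximable.
Proof.
split => [e e0|A hA e e0|A hA e e0].
- exists set0, set0; rewrite setC0; split => //; by rewrite setD0 measure0 lte_fin.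
- have [C [U [OC OU CA AU h]]] := hA _ e0.
  exists (~` U), (~` C); rewrite setTD setCK; split => //; try exact: subsetC.
  by rewrite setDE setCK setIC -setDE.
have e20 : 0 < e / 2 by rewrite divr_gt0.
have /choice[C /choice[U CU]] : forall i, exists C U,
  [/\ O (~` C), O U, C `<=` A i, A i `<=` U & (mu (U `\` C) < (e / 2 / (2 ^ i.+1)%:R)%:E)%E].
  move=> i; apply: hA; by rewrite divr_gt0// ltr0n expn_gt0.
have [N hN] : exists N, (mu (\bigcup_i U i `\` \big[setU/set0]_(i < N) C i) < e%:E)%E.
  apply: (@probability_tail_lt _ (g_sigma_algebraType O)) => [|i|].
  - by apply: mO; apply: Obigcup => i; case: (CU i).
  - by case: (CU i) => *; exact: mOC.
  have mUC i : measurable ((U i `\` C i) : set (g_sigma_algebraType O)).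
    by case: (CU i) => *; apply: measurableD; [exact: mO|exact: mOC].
  (* The series of gaps is only bounded by [e / 2] in the large sense; the spare half makes the
     final bound strict. *)
  apply: (@le_lt_trans _ _ (e / 2)%:E); last by rewrite lte_fin ltr_pdivrMr// ltr_pMr// ltr1n.
  apply: (@le_trans _ _ (\sum_(i <oo) (e / 2 / (2 ^ i.+1)%:R)%:E)%E); last first.
    by apply: epsilon_trick0; exact: ltW.
  apply: (@le_trans _ _ (\sum_(i <oo) mu (U i `\` C i))%E); last first.
    by apply: lee_nneseries => // i _; case: (CU i) => _ _ _ _ /ltW.
  apply: measure_sigma_subadditive => //.
    apply: measurableD; apply: bigcup_measurable => i _; case: (CU i) => *; [exact: mO|exact: mOC].
  by move=> x [[i _ Ui] nC]; exists i => //; split => // Ci; apply: nC; exists i.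
exists (\big[setU/set0]_(i < N) C i), (\bigcup_i U i); split => //.
- by apply: OCbigsetU => i; case: (CU i).
- by apply: Obigcup => i; case: (CU i).
- rewrite -bigcup_mkord => x [i _ Ci]; exists i => //.
  by case: (CU i) => _ _ CA _ _; exact: CA.
- by move=> x [i _ Ai]; exists i => //; case: (CU i) => _ _ _ AU _; exact: AU.
Qed.

(** The approximable sets form a sigma-algebra, and it contains the generators: by [Ofsigma] an open
    set is, up to small measure, a finite union of closed subsets, and it is its own outer
    approximant. *)
Lemma closed_inner_regular (A : set (g_sigma_algebraType O)) (e : R) :
  measurable A -> 0 < e ->
  exists C : set X, [/\ O (~` C), C `<=` A & (mu (A `\` C) < e%:E)%E].
Proof.
move=> mA e0.
have : approximable A.
  move: A mA; apply: smallest_sub; first exact: approximable_sigma_algebra.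
  move=> U OU d d0; have [C OC UE] := Ofsigma OU.
  have [N hN] : exists N, (mu (U `\` \big[setU/set0]_(i < N) C i) < d%:E)%E.
    apply: (@probability_tail_lt _ (g_sigma_algebraType O)) => [|i|].
    - exact: mO.
    - exact: mOC.
    - by rewrite -UE setDv measure0 lte_fin.
  exists (\big[setU/set0]_(i < N) C i), U; split => //; first exact: OCbigsetU.
  by rewrite -bigcup_mkord UE => x [i _ Ci]; exists i.
move=> /(_ _ e0)[C [U [OC OU CA AU h]]]; exists C; split => //.
apply: le_lt_trans h; apply: le_measure; rewrite ?inE; last exact: setSD.
- by apply: measurableD => //; exact: mOC.
- by apply: measurableD; [exact: mO|exact: mOC].
Qed.

End closed_inner_regularity.

Lemma invn_lt_eps (R : realType) (e : R) : 0 < e -> exists i, i.+1%:R^-1 < e.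
Proof.
move=> e0; exists (Num.truncn e^-1).
by rewrite invf_plt ?posrE// truncnS_gt.
Qed.

(** * Uniform topology on paths, separability and tightness *)

Section path_space.
Context {R : realType} {n : nat} (T : R).
Local Notation V := 'rV[R]_n.
Implicit Types (g h : R -> V) (e : R).

Definition uball g e : set (R -> V) :=
  [set h | forall t, 0 <= t <= T -> `|h t - g t| <= e].

Lemma unif_open0 : @unif_open R n T set0. Proof. by move=> g. Qed.

Lemma unif_openT : @unif_open R n T setT. Proof. by move=> g _; exists 1. Qed.

Lemma unif_openI (A B : set (R -> V)) :
  unif_open T A -> unif_open T B -> unif_open T (A `&` B).
Proof.
move=> hA hB g [/hA[a a0 ga] /hB[b b0 gb]].
exists (Num.min a b); first by rewrite lt_min a0.
move=> h gh; split; [apply: ga|apply: gb] => t /gh /le_trans; apply;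
  by rewrite ge_min lexx ?orbT.
Qed.

Lemma unif_open_bigcup (A : (set (R -> V))^nat) :
  (forall i, unif_open T (A i)) -> unif_open T (\bigcup_i A i).
Proof.
move=> hA g [i _ /hA[e e0 ge]]; exists e => // h /ge Aih; by exists i.
Qed.

Lemma uball_closed g e : unif_open T (~` uball g e).
Proof.
move=> h /existsNP[t /not_implyP[t0T /negP]]; rewrite -ltNge => hgt.
exists ((`|h t - g t| - e) / 2); first by rewrite divr_gt0// subr_gt0.
move=> k /(_ _ t0T) kh /(_ _ t0T) kg.
have : `|h t - g t| <= `|k t - h t| + `|k t - g t|.
  by rewrite (distrC (k t) (h t)) (le_trans _ (ler_normD _ _))// subrKA.
lra.
Qed.

Lemma uball_measurable g e : measurable (uball g e : set (cspace n T)).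
Proof.
rewrite -(setCK (uball g e)); apply: measurableC; apply: sub_sigma_algebra.
exact: uball_closed.
Qed.

Lemma unif_open_fsigma (U : set (R -> V)) : unif_open T U ->
  exists2 C : (set (R -> V))^nat,
    (forall i, unif_open T (~` C i)) & U = \bigcup_i C i.
Proof.
move=> hU.
(* These are the paths at distance at least [1 / (i + 1)] from the complement of [U]. The strict
   bound on [a] leaves the margin that makes [C i] closed. *)
pose C i : set (R -> V) := [set g | forall h a, a < i.+1%:R^-1 -> uball g a h -> U h].
exists C => [i g /existsNP[h /existsNP[a /not_implyP[ai /not_implyP[gh nUh]]]]|].
  rewrite /C; set r := i.+1%:R^-1 in ai *.
  exists ((r - a) / 2); first by rewrite divr_gt0// subr_gt0.
  move=> k kg /(_ h ((r + a) / 2)) ck; apply: nUh; apply: ck; first lra.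
  move=> t tT; have := kg t tT; have := gh t tT.
  have : `|h t - k t| <= `|h t - g t| + `|k t - g t|.
    by rewrite (distrC (k t) (g t)) (le_trans _ (ler_normD _ _))// subrKA.
  lra.
apply/seteqP; split => [g /[dup] Ug /hU[e e0 ge]|g [i _ Ci]]; last first.
  by apply: (Ci _ 0) => // t _; rewrite subrr normr0.
have [i ie] : exists i, i.+1%:R^-1 < e by exact: invn_lt_eps.
exists i => // h a ai gh; apply: ge => t /gh /le_trans; apply.
by rewrite ltW// (lt_trans ai).
Qed.

Lemma eval_unif_open t (U : set V) : 0 <= t <= T -> open U ->
  unif_open T [set g | U (g t)].
Proof.
move=> t0T oU g Ug.
have /nbhs_normP[e /= e0 eU] : nbhs (g t) U by exact: open_nbhs_nbhs.
exists (e / 2); first by rewrite divr_gt0.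
move=> h /(_ t t0T) ht; apply: eU => /=; rewrite distrC (le_lt_trans ht)//.
by rewrite ltr_pdivrMr// ltr_pMr// ltr1n.
Qed.

Lemma measurable_eval t : 0 <= t <= T ->
  measurable_fun (setT : set (cspace n T)) ((fun g => g t) : cspace n T -> borelRn R n).
Proof.
move=> t0T; apply: (@measurability _ _ (cspace n T) (borelRn R n) _ _ (@open V)) => // _ [U oU <-].
by rewrite setTI; apply: sub_sigma_algebra; exact: eval_unif_open.
Qed.

Lemma AC_unif_continuous g e : Defs.AC T g -> 0 < e -> exists2 d : R, 0 < d &
  forall s t, 0 <= s <= T -> 0 <= t <= T -> `|s - t| < d -> `|g s - g t| < e.
Proof.
move=> gAC e0; have [d d0 gd] := gAC e e0; exists d => //.
have main a b : 0 <= a -> a <= b -> b <= T -> b - a < d -> `|g b - g a| < e.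
  move=> a0 ab bT bad; have := gd 1%N (fun=> a) (fun=> b).
  by rewrite !big_ord1; apply => // i j; rewrite !ord1 eqxx.
move=> s t /andP[s0 sT] /andP[t0 tT]; have [st|/ltW ts] := leP s t.
- by rewrite distrC ger0_norm ?subr_ge0// distrC; exact: main.
- by rewrite ger0_norm ?subr_ge0//; exact: main.
Qed.

Lemma rV_rat_dense (x : V) e : 0 < e ->
  exists q : 'rV[rat]_n, `|x - map_mx ratr q| <= e.
Proof.
move=> e0.
have /choice[q qP] i : exists q : rat, `|x ord0 i - ratr q| <= e.
  have : x ord0 i - e < x ord0 i + e by lra.
  move=> /rat_in_itvoo[q]; rewrite in_itv/= => /andP[q1 q2].
  by exists q; rewrite ler_norml; lra.
exists (\row_i q i).
rewrite [leLHS]/Num.norm/= mx_normrE; apply/bigmax_leP; split; first exact: ltW.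
by move=> [i j] _ /=; rewrite !mxE ord1.
Qed.

(** Step functions with rational values on a grid of mesh [1 / (p.1 + 1)], equal to [0] beyond the
    end of the list. The code [p] ranges over a countable type, so that it can be enumerated by
    [unpickle]. *)
Definition rat_step (p : nat * seq 'rV[rat]_n) : R -> V :=
  fun t => map_mx ratr (nth 0 p.2 (Num.truncn (t * p.1.+1%:R))).

Definition path_net (i : nat) : R -> V :=
  if unpickle i is Some p then rat_step p else fun=> 0.

(** Uniform continuity lets [g] be sampled at grid points, each sample being rounded to a rational
    vector. The centres are discontinuous in general, which is harmless for closed balls of the sup
    distance. *)
Lemma path_net_dense g e : Defs.AC T g -> 0 < e -> exists i, uball (path_net i) e g.
Proof.
move=> gAC e0; have e20 : 0 < e / 2 by rewrite divr_gt0.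
have [d d0 gd] := AC_unif_continuous gAC e20.
have [N Nd] : exists N, N.+1%:R^-1 < d by exact: invn_lt_eps.
have /choice[q qP] k : exists q : 'rV[rat]_n, `|g (k%:R / N.+1%:R) - map_mx ratr q| <= e / 2.
  exact: rV_rat_dense.
(* The extra sample covers the grid cell that contains the endpoint [T]. *)
pose p := (N, mkseq q (Num.truncn (T * N.+1%:R)).+1).
exists (pickle p); rewrite /path_net pickleK => t /andP[t0 tT].
rewrite /rat_step/=; set k := Num.truncn (t * _).
have kT : (k < (Num.truncn (T * N.+1%:R)).+1)%N.
  by rewrite ltnS; apply: le_truncn; rewrite ler_pM2r.
rewrite nth_mkseq//.
have /andP[k1 k2] : k%:R <= t * N.+1%:R < k.+1%:R by apply: truncn_itv; rewrite mulr_ge0.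
have kt : k%:R / N.+1%:R <= t by rewrite ler_pdivrMr.
have tk : t - k%:R / N.+1%:R < N.+1%:R^-1.
  by rewrite ltrBlDl -[X in _ + X]mul1r -mulrDl natr1 ltr_pdivlMr.
have {}gd := gd t (k%:R / N.+1%:R).
have /ltW : `|g t - g (k%:R / N.+1%:R)| < e / 2.
  apply: gd; [by rewrite t0|rewrite divr_ge0//=; exact: le_trans tT|].
  rewrite ger0_norm ?subr_ge0//; exact: lt_trans Nd.
move=> h1; rewrite (splitr e) (le_trans _ (lerD h1 (qP k)))//.
by rewrite (le_trans _ (ler_normD _ _))// subrKA.
Qed.

Definition totally_bounded (K : set (R -> V)) := forall k : nat, exists N : nat,
  K `<=` \big[setU/set0]_(i < N) uball (path_net i) k.+1%:R^-1.

(** Ulam's argument: a closed subset of [A] costs [e / 2], and for each radius [1 / (k + 1)]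
    finitely many net balls cover [A] up to a mass of a geometric series with sum at most [e / 2].
    The intersection of all these sets is closed and totally bounded. *)
Lemma tight (eta : probability (cspace n T) R) (A : set (cspace n T)) e :
  measurable A -> A `<=` Defs.AC T -> 0 < e -> exists K : set (R -> V),
  [/\ unif_open T (~` K), totally_bounded K, K `<=` A &
      (eta (A `\` K) < e%:E)%E].
Proof.
move=> mA AAC e0; have e20 : 0 < e / 2 by rewrite divr_gt0.
have [C [oC CA etaC]] := closed_inner_regular eta unif_open0 unif_openT unif_openI
  unif_open_bigcup unif_open_fsigma mA e20.
have mC : measurable (C : set (cspace n T)).
  by rewrite -(setCK C); apply: measurableC; exact: sub_sigma_algebra.
pose U k N : set (cspace n T) := \big[setU/set0]_(i < N) uball (path_net i) k.+1%:R^-1.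
have mU k N : measurable (U k N).
  by apply: bigsetU_measurable => *; exact: uball_measurable.
have /choice[N NP] k : exists N, (eta (A `\` U k N) < (e / 2 / (2 ^ k.+1)%:R)%:E)%E.
  pose C' i : set (cspace n T) := uball (path_net i) k.+1%:R^-1.
  apply: (probability_tail_lt (C := C')) => // [i|]; first exact: uball_measurable.
  (* All the net balls of a given radius together cover [A], since its paths are absolutely
     continuous. *)
  rewrite [X in eta X](_ : _ = set0).
    by rewrite measure0 lte_fin divr_gt0// ltr0n expn_gt0.
  rewrite setD_eq0 => g /AAC gAC.
  have [|i gi] := @path_net_dense _ k.+1%:R^-1 gAC; first by rewrite invr_gt0.
  by exists i.
pose W : set (cspace n T) := \bigcap_k U k (N k).
have mW : measurable W by exact: bigcap_measurable.
exists (C `&` W); split.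
- rewrite setCI => g [nC|/existsNP[k /not_implyP[_ nU]]].
    by have [a a0 ga] := oC _ nC; exists a => // h /ga; left.
  have : unif_open T (~` U k (N k)).
    rewrite /U; elim: (N k) => [|m IH]; first by rewrite big_ord0 setC0; exact: unif_openT.
    by rewrite big_ord_recr/= setCU; apply: unif_openI => //; exact: uball_closed.
  move=> /(_ _ nU)[a a0 ga]; exists a => // h /ga nUh; right => /(_ k I).
  exact: nUh.
- by move=> k; exists (N k) => g [_ /(_ k I)].
- by move=> g [/CA].
apply: (@le_lt_trans _ _ (eta (A `\` C) + eta (A `\` W))%E).
  rewrite setDIr; apply: measureU2; exact: measurableD.
rewrite (splitr e) EFinD; apply: lte_leD => //; first by rewrite fin_num_measure//; exact: measurableD.
apply: (@le_trans _ _ (\sum_(i <oo) (e / 2 / (2 ^ i.+1)%:R)%:E)%E); last first.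
  by apply: epsilon_trick0; exact: ltW.
apply: (@le_trans _ _ (\sum_(i <oo) eta (A `\` U i (N i)))%E); last first.
  by apply: lee_nneseries => // i _; exact: ltW.
apply: measure_sigma_subadditive => //; try by [move=> i; exact: measurableD|exact: measurableD].
move=> g [Ag /existsNP[k /not_implyP[_ nU]]]; by exists k.
Qed.

End path_space.

Lemma ultra_bigsetU (X : Type) (G : set_system X) (A : (set X)^nat) N :
  UltraFilter G -> G (\big[setU/set0]_(i < N) A i) -> exists i, G (A i).
Proof.
move=> UG; elim: N => [|N IH]; first by rewrite big_ord0 => /filter_not_empty.
rewrite big_ord_recr/= => GA.
have [GN|GN] := in_ultra_setVsetC (A N) UG; first by exists N.
apply: IH; apply: filterS2 GA GN => x; by case.
Qed.

(** * Compact sets of paths, supports and comparison of tails *)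

Section compact_paths.
Context {R : realType} {n : nat} (T : R).
Local Notation V := 'rV[R]_n.
Implicit Types (g h : R -> V) (e : R).

(** Compactness through ultrafilters: for [x] in the closure, an ultrafilter [G] on [K] along which
    [g t0] tends to [x] contains arbitrarily small balls by total boundedness. It therefore
    converges uniformly, and its limit lies in the closed set [K] and passes through [x]. *)
Lemma closed_eval_image (K : set (R -> V)) t0 : 0 <= t0 <= T ->
  unif_open T (~` K) -> totally_bounded T K -> closed [set g t0 | g in K].
Proof.
move=> t0T oK tK x clx.
pose F : set_system (R -> V) :=
  filter_from [set e : R | 0 < e] (fun e => K `&` [set g | `|x - g t0| < e]).
have PF : ProperFilter F.
  apply: filter_from_proper.
    apply: filter_from_filter; first by exists 1 => /=.
    move=> a b /= a0 b0; exists (Num.min a b); first by rewrite /= lt_min a0.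
    by move=> g [Kg]/=; rewrite lt_min => /andP[].
  move=> e /= e0.
  have [_ [[g Kg <-] xg]] := clx _ (nbhsx_ballx x e e0).
  by exists g; split => //=; move: xg; rewrite -ball_normE.
have [G [UG FG]] := ultraFilterLemma PF.
have GK : G K by apply: FG; exists 1 => //= g [].
have small k : exists i, G (uball T (path_net i) k.+1%:R^-1).
  by have [N KN] := tK k; apply: (@ultra_bigsetU _ _ _ N) => //; exact: filterS GK.
have cvgG t : 0 <= t <= T -> cvg (g t @[g --> G]).
  move=> tT; apply: cauchy_cvg; apply: cauchy_exP => e e0.
  have [k ke] := invn_lt_eps e0; have [i Gi] := small k.
  exists (path_net i t); suff : G [set g | ball (path_net i t : V) e (g t)] by [].
  apply: (@filterS _ G _ (uball T (path_net i) k.+1%:R^-1)) => // g.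
  by move=> /(_ _ tT) gi /=; rewrite -ball_normE /= distrC (le_lt_trans gi).
pose l t := lim (g t @[g --> G]).
have lE t e : 0 <= t <= T -> 0 < e -> G [set g | `|l t - g t| < e].
  move=> tT e0; have /cvgrPdist_lt := cvgG _ tT; exact.
have Gl e : 0 < e -> G (uball T l e).
  move=> e0; have e20 : 0 < e / 2 by rewrite divr_gt0.
  have [k ke] := invn_lt_eps e20; have [i Gi] := small k.
  apply: filterS (Gi) => g gi t tT.
  rewrite (splitr e) (le_trans (ler_distD (path_net i t) _ _))// lerD//.
    by rewrite (le_trans (gi _ tT))// ltW.
  (* The limit [l t] inherits the bound on the distance to the centre, up to an arbitrary [c], from
     a path of the ball that is [c]-close to [l] at time [t]. *)
  apply/ler_addgt0Pr => c c0.
  have [h [/= h1 h2]] := filter_ex (filterI (lE _ _ tT c0) Gi).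
  rewrite [leRHS]addrC distrC (le_trans (ler_distD (h t) _ _))// lerD//; first exact: ltW.
  by rewrite (le_trans (h2 _ tT))// ltW.
exists l.
  apply: contrapT => nK; have [e e0 eK] := oK _ nK.
  have [g [Kg gl]] := filter_ex (filterI GK (Gl _ e0)).
  exact: (eK g).
apply/eqP; rewrite -subr_eq0 -normr_le0; apply/ler_addgt0Pr => c c0; rewrite add0r.
have c20 : 0 < c / 2 by rewrite divr_gt0.
have Gx : G [set g | `|x - g t0| < c / 2] by apply: FG; exists (c / 2) => //= g [].
have [h [/= h1 h2]] := filter_ex (filterI (lE _ _ t0T c20) Gx).
rewrite (splitr c) (le_trans (ler_distD (h t0) _ _))// lerD//; first exact: ltW.
by rewrite distrC ltW.
Qed.

(** Separability: a path of [B] outside the support lies in a null ball, hence in a null ball of the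
    countable net, and countably many null balls can be discarded together. *)
Lemma supp_full (Om : set V) (eta : probability (cspace n T) R) :
  on_Gamma Om eta -> exists B : set (cspace n T),
  [/\ measurable B, B `<=` supp Om eta & eta B = 1%E].
Proof.
move=> [B [mB BG B1]].
pose null i k := eta (uball T (path_net i) k.+1%:R^-1) == 0%E.
pose N : set (cspace n T) := \bigcup_i \bigcup_(k in [set k | null i k])
  uball T (path_net i) k.+1%:R^-1.
have mN : measurable N.
  apply: bigcup_measurable => i _; apply: bigcup_measurable => k _.
  exact: uball_measurable.
have N0 : eta N = 0%E.
  apply/negligibleP => //; apply: negligible_bigcup => i.
  rewrite bigcup_mkcond; apply: negligible_bigcup => k; case: ifPn.
    rewrite inE => /eqP ?; apply/negligibleP => //; exact: uball_measurable.
  by move=> _; exact: negligible_set0.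
exists (B `\` N); split; first exact: measurableD.
  move=> g [Bg nN]; split; first exact: BG.
  move=> e e0; rewrite lt_neqAle measure_ge0 andbT eq_sym; apply/eqP => eta0.
  apply: nN; have e20 : 0 < e / 2 by rewrite divr_gt0.
  have [k ke] := invn_lt_eps e20.
  have [gAC _] := BG _ Bg.
  have [|i gi] := @path_net_dense _ _ _ _ k.+1%:R^-1 gAC; first by rewrite invr_gt0.
  exists i => //; exists k => //=; rewrite /null -measure_le0 -eta0.
  apply: le_measure; rewrite ?inE; [exact: uball_measurable|exact: (uball_measurable g e)|].
  move=> h hi t tT; rewrite (splitr e) (le_trans (ler_distD (path_net i t) _ _))// lerD//.
    by rewrite (le_trans (hi _ tT))// ltW.
  by rewrite distrC (le_trans (gi _ tT))// ltW.
rewrite measureD//; last by rewrite (le_lt_trans (probability_le1 _ _)) ?ltry.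
rewrite [X in (_ - X)%E](_ : _ = 0%E) ?sube0//.
by apply: (subset_measure0 _ mN _ N0) => //; exact: measurableI.
Qed.

(* If [D g1 <= D g2] whenever [g1] and [g2] start at the same point, then the
   set of starting points of a compact part of [{D > s}] under [eta1] is Borel
   and every [eta2]-path issued from it has [D > s]. *)
Lemma tail_dominated (Om : set V) (eta1 eta2 : probability (cspace n T) R)
    (m0 : probability (borelRn R n) R) (S1 S2 : set (cspace n T))
    (D : cspace n T -> R) (s : R) : 0 <= T ->
  P_m0 Om m0 eta1 -> P_m0 Om m0 eta2 ->
  measurable S1 -> measurable S2 -> S1 `<=` Defs.AC T ->
  eta1 S1 = 1%E -> eta2 S2 = 1%E ->
  measurable_fun setT D ->
  (forall g1 g2, S1 g1 -> S2 g2 -> g1 0 = g2 0 -> D g1 <= D g2) ->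
  (eta1 [set g | (s < D g)%R] <= eta2 [set g | (s < D g)%R])%E.
Proof.
move=> T0 [_ h1] [_ h2] mS1 mS2 S1AC S11 S21 mD Dle.
have mDs : measurable [set g | s < D g].
  have := mD measurableT `]s, +oo[%classic (measurable_itv _).
  by rewrite setTI; congr measurable; apply/seteqP; split => g /=; rewrite in_itv/= andbT.
pose A := S1 `&` [set g | s < D g].
have mA : measurable A by exact: measurableI.
(* A set of full measure may be intersected with any event; this restricts each tail to the paths on
   which [Dle] applies. *)
have full (eta : probability (cspace n T) R) S E : measurable S -> measurable E ->
    eta S = 1%E -> eta E = eta (S `&` E).
  move=> mS mE S1'; rewrite setIC; apply/eqP; rewrite eq_le; apply/andP; split; last first.
    by apply: le_measure; rewrite ?inE//; exact: measurableI.
  have S0 : eta (~` S) = 0%E by rewrite probability_setC// S1' subee.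
  rewrite -{1}(setUIDK E S) -[leRHS]adde0.
  apply: (@le_trans _ _ (eta (E `&` S) + eta (E `\` S))%E).
    by apply: measureU2; [exact: measurableI|exact: measurableD].
  rewrite leeD2l// -S0; apply: le_measure; rewrite ?inE; [exact: measurableD|exact: measurableC|].
  by move=> x [].
rewrite (full _ S1)// -/A.
apply/lee_addgt0Pr => e e0.
have [|K [oK tK KA eAK]] := @tight _ _ _ eta1 A e mA _ e0; first by move=> g [/S1AC].
have mK : measurable (K : set (cspace n T)).
  by rewrite -(setCK K); apply: measurableC; exact: sub_sigma_algebra.
pose E : set (borelRn R n) := [set g 0 | g in K].
have t00 : (0 : R) <= 0 <= T by apply/andP.
have mE : measurable E.
  rewrite -(setCK E); apply: measurableC; apply: sub_sigma_algebra.
  by apply: closed_openC; exact: closed_eval_image.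
have mEe : measurable ([set g | E (g 0)] : set (cspace n T)).
  by have := measurable_eval t00 measurableT mE; rewrite setTI.
apply: (@le_trans _ _ (eta1 K + eta1 (A `\` K))%E).
  apply: (@le_trans _ _ (eta1 (K `|` (A `\` K)))); last by apply: measureU2 => //; exact: measurableD.
  apply: le_measure; rewrite ?inE//; first by apply: measurableU => //; exact: measurableD.
  by rewrite setDUK.
apply: leeD; last exact: ltW.
apply: (@le_trans _ _ (eta1 [set g | E (g 0)])).
  by apply: le_measure; rewrite ?inE// => g Kg; exists g.
(* The common initial marginal turns the probability of starting in [E] under [eta1] into the one
   under [eta2], by way of [m0 E]. *)
rewrite -h1// h2// (full eta2 S2)//.
apply: le_measure; rewrite ?inE//; first exact: measurableI.
move=> g2 [S2g [g1 Kg1 g12]] /=; have [S1g Dg] := KA _ Kg1.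
exact: lt_le_trans (Dle _ _ S1g S2g g12).
Qed.

End compact_paths.

(** * Integration by tails and joint measurability *)

Lemma bounded_integrable d (X : measurableType d) (R : realType)
    (mu : {measure set X -> \bar R}) (D : set X) (f : X -> R) M :
  measurable D -> (mu D < +oo)%E -> measurable_fun D f ->
  (forall x, D x -> `|f x| <= M) -> mu.-integrable D (EFin \o f).
Proof.
move=> mD muD mf fM; apply: measurable_bounded_integrable => //.
exists M; split; first exact: num_real.
by move=> r Mr x Dx /=; rewrite (le_trans (fM _ Dx))// ltW.
Qed.

(** Layer-cake formula: the shift by [M] makes [D] nonnegative, and its expectation is then the
    integral of its tails over the half-line. *)
Lemma le_integral_of_tails d (X : measurableType d) (R : realType)
    (P Q : probability X R) (D : X -> R) M :
  measurable_fun setT D -> (forall x, `|D x| <= M) ->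
  (forall s, (P [set x | (s < D x)%R] <= Q [set x | (s < D x)%R])%E) ->
  (\int[P]_x (D x)%:E <= \int[Q]_x (D x)%:E)%E.
Proof.
move=> mD DM PQ.
pose f x := D x + M.
have mf : measurable_fun setT f by exact: measurable_funD.
pose Y : {mfun X >-> R} := HB.pack_for {mfun X >-> R} f (isMeasurableFun.Build _ _ _ _ f mf).
have f0 x : 0 <= f x by rewrite /f; have := DM x; rewrite ler_norml; lra.
have EY (P' : probability X R) : (\int[P']_x (D x)%:E + M%:E =
    \int[lebesgue_measure]_(r in `[0%R, +oo[) P' [set x | (r - M < D x)%R])%E.
  transitivity ('E_P'[Y])%E.
    rewrite expectation_def /= /f.
    under [RHS]eq_integral do rewrite EFinD.
    have iD : P'.-integrable setT (EFin \o D).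
      by apply: (@bounded_integrable _ _ _ _ _ _ M) => //; rewrite (le_lt_trans (probability_le1 _ _)) ?ltry.
    rewrite integralD//; last exact: finite_measure_integrable_cst.
    rewrite integral_cst// [X in (_ * X)%E](_ : _ = 1%E) ?mule1//; exact: probability_setT.
  rewrite ge0_expectation_ccdf//; apply: eq_integral => r _.
  rewrite /ccdf /distribution /pushforward/=; congr (P' _).
  by apply/seteqP; split => x /=; rewrite in_itv/= andbT /f ltrBlDr.
rewrite -(leeD2rE _ _ (_ : M%:E \is a fin_num))// !EY.
have mtail (P' : probability X R) :
    measurable_fun [set: R] (fun r => P' [set x | (r - M < D x)%R]).
  apply: eq_measurable_fun (@ccdf_measurable _ _ _ P' Y) => r _.
  rewrite /ccdf /distribution /pushforward/=; congr (P' _).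
  by apply/seteqP; split => x /=; rewrite in_itv/= andbT /f ltrBlDr.
by apply: ge0_le_integral => //; exact: measurable_funTS (mtail _).
Qed.

(** Carathéodory functions are jointly measurable: rounding the time down to a grid gives a function
    that is measurable on countably many strips, and continuity in time gives pointwise convergence
    as the mesh shrinks. *)
Lemma measurable_continuous_uncurry d (X : measurableType d) (R : realType) (h : R -> X -> R) :
  (forall s, measurable_fun setT (h s)) -> (forall x, continuous (h ^~ x)) ->
  measurable_fun setT (fun p : R * X => h p.1 p.2).
Proof.
move=> mh ch.
pose r N (s : R) : R := (Num.floor (s * N.+1%:R))%:~R / N.+1%:R.
apply: (@measurable_fun_cvg _ _ _ _ (fun N p => h (r N p.1) p.2)) => [N|[s x] _ /=]; last first.
  apply: (@cvg_comp _ _ _ (r^~ s) (h^~ x) _ (nbhs s)); last exact: ch.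
  apply/cvgrPdist_le => e e0.
  have [k ke] := invn_lt_eps e0.
  exists k => // N /= kN.
  have N0 : (0 : R) < N.+1%:R by [].
  have /andP[a b] := floor_itv (s * N.+1%:R).
  have rs : r N s <= s by rewrite /r ler_pdivrMr.
  have sr : s <= r N s + N.+1%:R^-1.
    by rewrite /r -[X in _ + X]mul1r -mulrDl ler_pdivlMr// -[1]/(1%:~R) -intrD ltW.
  rewrite ger0_norm ?subr_ge0// lerBlDl (le_trans sr)// lerD2l.
  by rewrite (le_trans _ (ltW ke))// lef_pV2 ?posrE// ler_nat.
move=> _ Y mY.
rewrite setTI [X in measurable X](_ : _ = \bigcup_(k : int)
  ([set s | Num.floor (s * N.+1%:R) = k] `*` (h (k%:~R / N.+1%:R) @^-1` Y))).
  apply: countable_bigcupT_measurable => [|k]; first exact: countableP.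
  apply: measurableX; last first.
    by have := mh (k%:~R / N.+1%:R) measurableT Y mY; rewrite setTI.
  rewrite [X in measurable X](_ : _ = `[k%:~R / N.+1%:R, (k + 1)%:~R / N.+1%:R[%classic) //.
  have N0 : (0 : R) < N.+1%:R by [].
  apply/seteqP; split => s /=; rewrite in_itv/= ler_pdivrMr// ltr_pdivlMr//.
    by move=> <-; exact: floor_itv.
  by move=> /floor_def.
by apply/seteqP; split => [[s x] /= Yh|[s x] /= [k _ [/= <-]]//]; exists (Num.floor (s * N.+1%:R)).
Qed.

Section clamp.
Context {R : realType} (T : R).

(** Precomposition with this 1-Lipschitz retraction extends data given on [[0, T]] continuously to
    the whole line. *)
Definition clamp (s : R) := Num.max 0 (Num.min s T).

Lemma clamp_itv s : 0 <= T -> 0 <= clamp s <= T.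
Proof. by move=> T0; rewrite /clamp le_max lexx ge_max T0 ge_min lexx orbT. Qed.

Lemma clamp_id s : 0 <= s <= T -> clamp s = s.
Proof. by move=> /andP[s0 sT]; rewrite /clamp (min_idPl sT) (max_idPr s0). Qed.

Lemma clamp_dist s t : `|clamp s - clamp t| <= `|s - t|.
Proof.
rewrite /clamp /Num.max /Num.min.
by repeat case: ifPn => //; rewrite -?leNgt => *; rewrite ?subrr ?normr0 ?ler_norml//;
  have := ler_norm (s - t); have := ler_norm (t - s); rewrite distrC; lra.
Qed.

End clamp.

(** * Measurability of the Lagrangian along a path *)

Section measurable_derivative.
Context {R : realType} {n : nat}.
Local Notation V := 'rV[R]_n.
Variable G : R -> V.
Hypothesis cG : continuous G.

Let q (h s : R) : V := h^-1 *: (G (h + s) - G s).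

Let cq h : continuous (q h).
Proof.
move=> s; apply: cvgZr; apply: cvgB; last exact: cG.
apply: (@cvg_comp _ _ _ (fun s => h + s) G _ (nbhs (h + s))); last exact: cG.
by apply: cvgD; [exact: cvg_cst|exact: cvg_id].
Qed.

(** For a continuous [G] this is an intersection of closed conditions, even though it is indexed by
    uncountably many pairs of steps. Differentiability is the Cauchy criterion for the quotients, a
    countable combination of such sets. *)
Let nearly_cauchy j k : set R := \bigcap_(p in [set p : R * R |
    (0 < `|p.1| < j.+1%:R^-1) && (0 < `|p.2| < j.+1%:R^-1)])
  [set s | `|q p.1 s - q p.2 s| <= k.+1%:R^-1].

Let nearly_cauchy_measurable j k : measurable (nearly_cauchy j k).
Proof.
apply: closed_measurable; apply: closed_bigI => -[h h'] _ /=.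
apply: (@closed_comp _ _ (fun s => `|q h s - q h' s|) [set x | x <= k.+1%:R^-1]); last exact: closed_le.
by move=> s _; apply: cvg_norm; apply: cvgB; exact: cq.
Qed.

Definition differentiability_set : set R := [set s | cvg (q^~ s @ 0^')].

Let differentiability_setE :
  differentiability_set = \bigcap_k \bigcup_j nearly_cauchy j k.
Proof.
apply/seteqP; split => [s /= cvs k _|s hs].
  have k0 : (0 : R) < k.+1%:R^-1 / 2 by rewrite divr_gt0.
  have /cvgrPdist_lt /(_ _ k0) := cvs.
  move=> /nbhs_ballP[d /= d0 hd].
  have [j jd] := invn_lt_eps d0; exists j => // -[h h'] /= /andP[/andP[h0 hj] /andP[h'0 h'j]].
  have near0 (x : R) : 0 < `|x| -> `|x| < j.+1%:R^-1 ->
      `|lim (q^~ s @ 0^') - q x s| < k.+1%:R^-1 / 2.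
    move=> x0 xj; apply: hd; last by rewrite -normr_gt0.
    by rewrite -ball_normE /= sub0r normrN (lt_trans xj).
  rewrite (splitr (k.+1%:R^-1)) (le_trans (ler_distD (lim (q^~ s @ 0^')) _ _))// lerD//.
    by rewrite distrC ltW// near0.
  by rewrite ltW// near0.
apply: cauchy_cvg; apply: cauchy_exP => e e0.
have [k ke] := invn_lt_eps e0; have [j _ hj] := hs k I.
(* The step [1 / (j + 2)] is nonzero and strictly below [1 / (j + 1)], so its quotient can serve as
   the centre required by the Cauchy criterion. *)
exists (q j.+2%:R^-1 s).
apply/nbhs_ballP; exists j.+1%:R^-1 => /=; first by rewrite invr_gt0.
move=> x; rewrite -ball_normE /= sub0r normrN => xj x0.
rewrite -ball_normE /=; apply: le_lt_trans ke.
apply: (hj (j.+2%:R^-1, x)) => /=; rewrite xj (normr_gt0 x) x0 !andbT.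
by rewrite normfV ger0_norm// invr_gt0 ltr0n/= ltf_pV2 ?posrE// ltr_nat.
Qed.

Lemma measurable_differentiability_set : measurable differentiability_set.
Proof.
rewrite differentiability_setE; apply: bigcap_measurable => // k _.
by apply: bigcup_measurable => j _; exact: nearly_cauchy_measurable.
Qed.

(** On the differentiability set the function is a pointwise limit of the continuous functions
    obtained from difference quotients. On the complement the derivative takes a constant default
    value. *)
Lemma measurable_lagrangian_derive1 (Om : set V) (L : V -> V -> R) :
  (forall s, closure Om (G s)) -> cont_OmV Om L ->
  measurable_fun setT (fun s => L (G s) (derive1 G s)).
Proof.
move=> GOm cL.
have cLG (v : R -> V) : continuous v -> continuous (fun s => L (G s) (v s)).
  move=> cv s; apply/cvgrPdist_lt => e e0.
  have [d d0 Ld] := cL _ (v s) (GOm s) e e0.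
  have /cvgrPdist_lt /(_ _ d0) Gd := @cG s.
  have /cvgrPdist_lt /(_ _ d0) vd := @cv s.
  near=> t; rewrite distrC; apply: Ld => //; rewrite distrC; near: t => //.
rewrite -(setUv differentiability_set); apply/measurable_funU.
- exact: measurable_differentiability_set.
- by apply: measurableC; exact: measurable_differentiability_set.
split.
  apply: (@measurable_fun_cvg _ _ _ _ (fun N s => L (G s) (q N.+1%:R^-1 s))) => [N|s].
    by apply: measurable_funTS; apply: continuous_measurable_fun; exact/cLG/cq.
  move=> /= cvs.
  have cvq : q N.+1%:R^-1 s @[N --> \oo] --> derive1 G s.
    apply: (@cvg_comp _ _ _ (fun N : nat => N.+1%:R^-1 : R) (q^~ s) _ (0^')); last exact: cvs.
    move=> A /nbhs_ballP[d /= d0 Ad].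
    have [k kd] := invn_lt_eps d0; exists k => // N /= kN; apply: Ad => /=.
      rewrite -ball_normE /= sub0r normrN ger0_norm// (le_lt_trans _ kd)//.
      by rewrite lef_pV2 ?posrE// ler_nat.
    by rewrite invr_eq0.
  apply/cvgrPdist_lt => e e0.
  have [d d0 Ld] := cL _ (derive1 G s) (GOm s) e e0.
  have /cvgrPdist_lt /(_ _ d0) vd := cvq.
  near=> N; rewrite distrC; apply: Ld => //; first by rewrite subrr normr0.
  by rewrite distrC; near: N.
(* [derive1] is a [lim], and a divergent [lim] equals [point]. *)
apply: (@eq_measurable_fun _ _ _ _ _ (fun s => L (G s) point)) => [s|].
  by rewrite inE => ncv; rewrite /derive1 dvgP.
apply: measurable_funTS; apply: continuous_measurable_fun; apply: cLG => s.
exact: cvg_cst.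
Unshelve. all: by end_near.
Qed.

End measurable_derivative.

Section paths.
Context {R : realType} {n : nat} (T : R).
Local Notation V := 'rV[R]_n.
Hypothesis T0 : 0 < T.

Lemma Gamma_clamp_continuous (Om : set V) g : Gamma T Om g -> continuous (g \o clamp T).
Proof.
move=> [gAC _] s; apply/cvgrPdist_lt => e e0.
have [d d0 gd] := AC_unif_continuous gAC e0.
apply/nbhs_ballP; exists d => //= t /= st.
by apply: gd; rewrite ?clamp_itv ?ltW// (le_lt_trans (clamp_dist _ _ _)).
Qed.

Lemma Gamma_lagrangian_measurable (Om : set V) L g : cont_OmV Om L -> Gamma T Om g ->
  measurable_fun `[0, T] (fun s => L (g s) (derive1 g s)).
Proof.
(* The endpoints are dropped, because the derivatives of [g] and of its clamped extension are known
   to agree only inside the interval. *)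
move=> cL Gg; apply: (@measurable_fun_itv_cc _ _ _ false true).
pose G := g \o clamp T.
apply: (@eq_measurable_fun _ _ _ _ _ (fun s => L (G s) (derive1 G s))) => [s|].
  rewrite inE/= in_itv/= => /andP[s0 sT].
  have nearG : {near s, G =1 g}.
    have : s \in `]0, T[ by rewrite in_itv/= s0.
    move=> /near_in_itvoo; apply: filterS => t; rewrite in_itv/= => /andP[t0 tT].
    by rewrite /G/= clamp_id// !ltW.
  congr (L _ _); first exact: (nbhs_singleton nearG).
  rewrite !derive1E; exact: near_eq_derive.
apply: measurable_funTS; apply: measurable_lagrangian_derive1 cL.
- exact: Gamma_clamp_continuous Gg.
- by move=> s; case: Gg => _; apply; rewrite clamp_itv ?ltW.
Qed.

End paths.

(** * Relative continuity on a closed set: boundedness and Borel measurability *)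

Definition eps_cont_on (R : realType) (W : normedModType R) (C : set W) (f : W -> R) :=
  forall x, C x -> forall e : R, 0 < e -> exists2 d : R, 0 < d &
    forall y, C y -> `|y - x| < d -> `|f y - f x| < e.

Lemma eps_cont_on_bounded (R : realType) (W : normedModType R) (C : set W) (f : W -> R) :
  compact C -> eps_cont_on C f -> exists M, forall x, C x -> `|f x| <= M.
Proof.
move=> cC cf; apply: contrapT => /forallNP unb.
have /choice[u uP] (N : nat) : exists x, C x /\ N%:R < `|f x|.
  have /existsNP[x /not_implyP[Cx /negP]] := unb N%:R.
  by rewrite -ltNge => ?; exists x.
have [p [Cp clp]] : C `&` cluster (u @ \oo) !=set0.
  by apply: cC; exists 0%N => // N _ /=; case: (uP N).
have [d d0 fd] := cf p Cp 1 ltr01.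
pose N0 := (Num.truncn (`|f p| + 1)).+1.
have tl : (u @ \oo) [set u N | N in [set N | (N0 <= N)%N]].
  by exists N0 => // N /= N0N; exists N.
have [_ [[N /= N0N <-] pN]] := clp _ _ tl (nbhsx_ballx p d d0).
have [CN fN] := uP N.
have := fd (u N) CN; rewrite distrC; move: pN; rewrite -ball_normE /= => -> /(_ isT).
have : `|f (u N)| <= `|f (u N) - f p| + `|f p|.
  by rewrite (le_trans _ (ler_normD _ _))// subrK.
have : (N0%:R : R) <= N%:R by rewrite ler_nat.
have : `|f p| + 1 < N0%:R by exact: truncnS_gt.
lra.
Qed.

Section borelRn.
Context {R : realType} {n : nat}.
Local Notation V := 'rV[R]_n.

Lemma closed_borelRn (C : set V) : closed C -> measurable (C : set (borelRn R n)).
Proof.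
move=> cC; rewrite -(setCK C); apply: measurableC; apply: sub_sigma_algebra.
exact: closed_openC.
Qed.

(** The superlevel sets of [f] in [C] are closed, and half-lines [[a, +oo[] generate the Borel sets
    of the line. *)
Lemma eps_cont_on_measurable (C : set V) (f : V -> R) : closed C ->
  eps_cont_on C f -> measurable_fun (C : set (borelRn R n)) (f : borelRn R n -> R).
Proof.
move=> cC cf _; apply: (measurability _ (RGenCInfty.measurableE R)); last exact: closed_borelRn.
move=> _ [_ [a ->] <-]; apply: closed_borelRn => x clx.
have Cx : C x by apply: cC => A /clx[y [[Cy _] Ay]]; exists y.
split => //=; rewrite in_itv/= andbT leNgt; apply/negP => fxa.
have [|d d0 fd] := cf x Cx (a - f x); first by rewrite subr_gt0.
have [y [[Cy /=]]] := clx _ (nbhsx_ballx x d d0).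
rewrite in_itv/= andbT -ball_normE /= distrC => ay /(fd y Cy).
by rewrite ltNge ger0_norm ?lerD2r ?ay// subr_ge0 (le_trans (ltW fxa)).
Qed.

Lemma bounded_closure_norm (Om : set V) : bounded_set Om ->
  exists M, forall x, closure Om x -> `|x| <= M.
Proof.
move=> [M [_ OmM]]; exists (M + 2) => x clx.
have [y [Oy]] := clx _ (nbhsx_ballx x 1 ltr01); rewrite -ball_normE /= => xy.
have yM : `|y| <= M + 1 by apply: OmM => //; rewrite ltrDl.
have : `|x| <= `|x - y| + `|y| by rewrite (le_trans _ (ler_normD _ _))// subrK.
lra.
Qed.

Lemma closure_compact (Om : set V) : bounded_set Om -> compact (closure Om).
Proof.
move=> /bounded_closure_norm[M OmM]; apply: bounded_closed_compact; last exact: closed_closure.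
exists M; split; first exact: num_real.
by move=> r Mr x /OmM /le_trans; apply; exact: ltW.
Qed.

End borelRn.

(** * Flows of marginals and their continuity in time *)

Section flow.
Context {R : realType} {n : nat} (T : R) (Om : set 'rV[R]_n).
Local Notation V := 'rV[R]_n.
Hypothesis T0 : 0 < T.
Hypothesis bOm : bounded_set Om.
Variables (eta : probability (cspace n T) R) (B : set (cspace n T)).
Hypotheses (mB : measurable B) (BG : B `<=` Gamma T Om) (B1 : eta B = 1%E).
Implicit Type m : R -> probability (borelRn R n) R.

Let cOm : closed (closure Om). Proof. exact: closed_closure. Qed.

Let etaC : eta (~` B) = 0%E.
Proof. by rewrite probability_setC// B1 subee. Qed.

Let eta_lty (A : set (cspace n T)) : measurable A -> (eta A < +oo)%E.
Proof. by move=> mA; rewrite (le_lt_trans (probability_le1 _ _)) ?ltry. Qed.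

Lemma measurable_eval_comp (f : V -> R) t : eps_cont_on (closure Om) f ->
  0 <= t <= T -> measurable_fun B (fun g => f (g t)).
Proof.
move=> cf tT.
apply: (@measurable_comp _ _ _ (cspace n T) (borelRn R n) _ (closure Om) f B (fun g => g t)).
- exact: closed_borelRn.
- by move=> _ [g Bg <-]; have [_] := BG Bg; exact.
- exact: eps_cont_on_measurable.
- by apply: measurable_funTS; exact: measurable_eval.
Qed.

Lemma integrable_eval_comp (f : V -> R) t : eps_cont_on (closure Om) f ->
  0 <= t <= T -> eta.-integrable B (fun g => (f (g t))%:E).
Proof.
move=> cf tT; have [M fM] := eps_cont_on_bounded (closure_compact bOm) cf.
apply: (@bounded_integrable _ (cspace n T) _ eta B (fun g => f (g t)) M) => //.
- exact: eta_lty.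
- exact: measurable_eval_comp.
- by move=> g Bg; apply: fM; have [_] := BG Bg; exact.
Qed.

Lemma flow_Pbar m t : is_flow eta m -> 0 <= t <= T -> Pbar Om (m t).
Proof.
move=> fm tT; rewrite /Pbar fm//; last by apply: measurableC; exact: closed_borelRn.
apply/eqP; rewrite -measure_le0 -etaC; apply: le_measure; rewrite ?inE.
- have mC : measurable (~` closure Om : set (borelRn R n)).
    by apply: measurableC; exact: closed_borelRn.
  by have := measurable_eval tT measurableT mC; rewrite setTI.
- exact: measurableC.
- by move=> g /= ng Bg; apply: ng; have [_] := BG Bg; exact.
Qed.

Lemma flow_integral m (f : V -> R) t : is_flow eta m ->
  eps_cont_on (closure Om) f -> 0 <= t <= T ->
  (\int[m t]_(x in closure Om) (f x)%:E = \int[eta]_(g in B) (f (g t))%:E)%E.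
Proof.
move=> fm cf tT.
have [M fM] := eps_cont_on_bounded (closure_compact bOm) cf.
(* [f] is arbitrary off the closure of [Om]; its extension by zero is Borel on the whole space, as
   the change of variables requires. *)
pose phi : borelRn R n -> R := f \_ (closure Om).
have mphi : measurable_fun setT phi.
  apply/(@measurable_restrictT _ _ (borelRn R n) _ (closure Om) f); first exact: closed_borelRn.
  exact: eps_cont_on_measurable.
have phiE g : B g -> phi (g t) = f (g t).
  by move=> Bg; rewrite /phi patchE ifT// inE; have [_] := BG Bg; exact.
have iphi : eta.-integrable setT (EFin \o (phi \o (fun g : cspace n T => (g t : borelRn R n)))).
  apply: (@bounded_integrable _ _ _ _ _ _ `|M|) => //; first exact: eta_lty.
    by apply: measurableT_comp => //; exact: measurable_eval.
  move=> g _ /=; rewrite /phi patchE; case: ifPn; last by rewrite normr0.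
  by rewrite inE => /fM /le_trans; apply; exact: ler_norm.
rewrite integral_mkcond.
transitivity (\int[m t]_x (phi x)%:E)%E.
  by apply: eq_integral => x _; rewrite /phi !patchE; case: ifPn.
transitivity (\int[pushforward eta (fun g : cspace n T => (g t : borelRn R n))]_x (phi x)%:E)%E.
  by apply: eq_measure_integral => [|mt A mA _]; [exact: measurable_eval|exact: fm].
rewrite (integral_pushforward (measurable_eval tT))//; last exact/measurable_EFinP.
rewrite preimage_setT.
rewrite (@negligible_integral _ _ _ _ _ (~` B))//; last exact: measurableC.
rewrite setTD setCK; apply: eq_integral => g; rewrite inE => Bg /=.
by rewrite phiE.
Qed.

Lemma measurable_dist_eval s t : 0 <= s <= T -> 0 <= t <= T ->
  measurable_fun (setT : set (cspace n T)) (fun g => `|g s - g t|).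
Proof.
move=> sT tT; apply: (measurability _ (RGenOInfty.measurableE R)) => _ [_ [a ->] <-].
rewrite setTI; apply: sub_sigma_algebra => g /=; rewrite in_itv/= andbT => agst.
(* Moving both ends by a quarter of the gap loses at most half of it, so the inequality stays
   strict. *)
exists ((`|g s - g t| - a) / 4); first by rewrite divr_gt0// subr_gt0.
move=> h hg; rewrite /= in_itv/= andbT; have := hg s sT; have := hg t tT.
have : `|g s - g t| <= `|h s - g s| + `|h s - h t| + `|h t - g t|.
  rewrite (le_trans (ler_distD (h s) _ _))// (distrC (g s)) -addrA lerD2l.
  exact: ler_distD.
lra.
Qed.

(** The joint law of [g s] and [g t] under [eta] is a coupling of the two marginals, and a
    1-Lipschitz test function varies by at most the distance between them. *)
Lemma flow_KR_le m s t : is_flow eta m -> 0 <= s <= T -> 0 <= t <= T ->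
  (KR Om (m s) (m t) <= \int[eta]_(g in B) (`|g s - g t|)%:E)%E.
Proof.
move=> fm sT tT; apply: ge_ereal_sup => _ [phi lphi <-].
have cphi : eps_cont_on (closure Om) phi.
  by move=> x Ox e e0; exists e => // y Oy; apply: le_lt_trans; exact: lphi.
have [M OmM] := bounded_closure_norm bOm.
rewrite !(flow_integral fm cphi)// -integralB_EFin//; [|exact: integrable_eval_comp..].
apply: le_integral => //.
- by apply: integrableB => //; exact: integrable_eval_comp.
- apply: (@bounded_integrable _ (cspace n T) _ eta B (fun g => `|g s - g t|) (M + M)) => //.
  + exact: eta_lty.
  + by apply: measurable_funTS; exact: measurable_dist_eval.
  + move=> g Bg; rewrite normr_id (le_trans (ler_normB _ _))//.
    by have [_ gOm] := BG Bg; apply: lerD; apply: OmM; exact: gOm.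
- move=> g; rewrite inE => Bg; have [_ gOm] := BG Bg.
  by rewrite -EFinB lee_fin (le_trans (ler_norm _))//; apply: lphi; exact: gOm.
Qed.

(** By [flow_KR_le] it is enough that the mean displacement tends to zero. Paths are continuous and
    stay in a bounded set, so dominated convergence applies along a sequence of supposed
    counterexamples. *)
Lemma flow_KR_continuous m t e : is_flow eta m -> 0 <= t <= T -> 0 < e ->
  exists2 d : R, 0 < d & forall s, 0 <= s <= T -> `|s - t| < d ->
    (KR Om (m t) (m s) < e%:E)%E.
Proof.
move=> fm tT e0; apply: contrapT => nd.
have /choice[u uP] (k : nat) : exists s, [/\ 0 <= s <= T, `|s - t| < k.+1%:R^-1 &
    ~ (KR Om (m t) (m s) < e%:E)%E].
  apply: contrapT => /forallNP nk; apply: nd; exists k.+1%:R^-1; first by rewrite invr_gt0.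
  by move=> s sT st; apply: contrapT => nKR; apply: (nk s).
have uT k : 0 <= u k <= T by case: (uP k).
have [M OmM] := bounded_closure_norm bOm.
have : (\int[eta]_(g in B) (`|g t - g (u k)|)%:E)%E @[k --> \oo] --> (\int[eta]_(g in B) cst 0 g)%E.
  have [] // := @dominated_convergence _ (cspace n T) _ eta B mB
    (fun k g => (`|g t - g (u k)|)%:E) (cst 0%E) (EFin \o cst (M + M)).
  - by move=> k; apply/measurable_EFinP; apply: measurable_funTS; exact: measurable_dist_eval.
  - apply: aeW => g Bg; apply: cvg_EFin; first by near=> k.
    have [gAC gOm] := BG Bg; apply/cvgrPdist_lt => a a0.
    have [d d0 gd] := AC_unif_continuous gAC a0.
    have [k kd] := invn_lt_eps d0.
    exists k => // N /= kN; rewrite sub0r normrN normr_id; apply: gd => //.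
    rewrite distrC; have [_ + _] := uP N; move=> /lt_trans; apply.
    by rewrite (le_lt_trans _ kd)// lef_pV2 ?posrE// ler_nat.
  - exact: finite_measure_integrable_cst.
  - apply: aeW => g k Bg; have [_ gOm] := BG Bg.
    rewrite lee_fin normr_id (le_trans (ler_normB _ _))//.
    by apply: lerD; apply: OmM; exact: gOm.
rewrite integral0 => cv0.
have : nbhs (0 : \bar R)%E [set x | (x < e%:E)%E].
  by apply: open_nbhs_nbhs; split; [exact: open_ereal_lt_ereal|rewrite /= lte_fin].
move=> /cv0[N _ /(_ N (leqnn N)) /=]; have [_ _ nKR] := uP N => lte.
by apply: nKR; apply: le_lt_trans lte; exact: flow_KR_le.
Unshelve. all: by end_near.
Qed.

Lemma flow_eps_cont m (H : V -> probability (borelRn R n) R -> R) :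
  cont_OmP Om H -> is_flow eta m ->
  eps_cont_on (`[0, T] `*` closure Om) (fun p : R * V => H p.2 (m p.1)).
Proof.
move=> cH fm [t x] [/=]; rewrite in_itv/= => tT Ox e e0.
have [d d0 Hd] := cH x (m t) Ox (flow_Pbar fm tT) e e0.
have [d' d'0 md] := flow_KR_continuous fm tT d0.
exists (Num.min d d'); first by rewrite lt_min d0.
move=> [s y] [/=]; rewrite in_itv/= => sT Oy.
rewrite [X in X < _ -> _]/Num.norm/= gt_max !lt_min => /andP[/andP[_ st] /andP[yx _]].
by apply: Hd => //; [exact: flow_Pbar|exact: md].
Qed.

End flow.

Lemma KR_eq_measure (R : realType) (n : nat) (Om : set 'rV[R]_n)
    (mu nu : probability (borelRn R n) R) :
  (forall A, measurable A -> mu A = nu A) -> (KR Om mu nu <= 0)%E.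
Proof.
move=> munu; apply: ge_ereal_sup => _ [phi lphi <-].
rewrite (eq_measure_integral nu) => [|A mA _]; last exact: munu.
(* No integrability of [phi] is at hand here; the difference of two equal infinities is [-oo] by
   convention, which is still nonpositive. *)
have h (x : \bar R) : (x - x <= 0)%E by case: x => [r||]; [rewrite subee|exact: leNye|exact: leNye].
exact: h.
Qed.

(* A [probability] is a set function defined on all sets, so two flows of the
   same [eta] may differ on nonmeasurable sets and need not be equal. *)
Lemma cont_OmP_eq_measure (R : realType) (n : nat) (Om : set 'rV[R]_n)
    (H : 'rV[R]_n -> probability (borelRn R n) R -> R) mu nu x :
  cont_OmP Om H -> Pbar Om mu -> Pbar Om nu ->
  (forall A, measurable A -> mu A = nu A) -> closure Om x -> H x mu = H x nu.
Proof.
move=> cH Pmu Pnu munu Ox; apply/eqP; rewrite eq_sym -subr_eq0 -normr_le0.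
apply/ler_addgt0Pr => e e0; rewrite add0r ltW//.
have [d d0] := cH x mu Ox Pmu e e0; apply => //; first by rewrite subrr normr0.
by rewrite (le_lt_trans (KR_eq_measure _ munu))// lte_fin.
Qed.

Lemma lebesgue_itv_lty (R : realType) (a b : R) :
  (@lebesgue_measure R `[a, b]%classic < +oo)%E.
Proof. by rewrite lebesgue_measure_itv/=; case: ifPn => _; rewrite -?EFinB ltry. Qed.

(** * Exchange of the time integral and the path integral *)

Section bounded_fubini.
Context d (X : measurableType d) (R : realType) (P : probability X R).
Variables (T M : R) (h : R -> X -> R).
Hypothesis mh : measurable_fun setT (fun p : R * X => h p.1 p.2).
Hypothesis hM : forall s x, `|h s x| <= M.
Local Notation mu := (@lebesgue_measure R).

(** Extension by zero off [[0, T]] reduces the restricted time integral to Fubini's theorem on the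
    whole line. *)
Let H : R * X -> \bar R := (fun p => (h p.1 p.2)%:E) \_ (`[0, T]%classic `*` setT).

Let mH : measurable_fun setT H.
Proof.
have mD : measurable (`[0, T]%classic `*` setT : set (R * X)) by exact: measurableX.
by apply/(measurable_restrictT _ mD); apply: measurable_funTS; exact/measurable_EFinP.
Qed.

Let HE s : `[0, T]%classic s -> (fun x => H (s, x)) = (fun x => (h s x)%:E).
Proof. by move=> sT; apply/funext => x; rewrite /H patchE ifT// inE. Qed.

Let HN s : ~ `[0, T]%classic s -> (fun x => H (s, x)) = cst 0%E.
Proof.
by move=> sT; apply/funext => x; rewrite /H patchE ifF//; apply/negP; rewrite inE => -[].
Qed.

Let iH : (mu \x P)%E.-integrable setT H.
Proof.
apply/(integrable12ltyP mu P mH).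
apply: (@le_lt_trans _ _ (\int[mu]_(s in `[0%R, T]) (`|M|%R)%:E)%E); last first.
  rewrite integral_cst// lte_mul_pinfty//; exact: lebesgue_itv_lty.
rewrite [leRHS]integral_mkcond; apply: ge0_le_integral => //.
- by move=> s _; exact: integral_ge0.
- by apply: (measurable_fun_fubini_tonelli_F (abse \o H)) => //=; exact: measurableT_comp.
- by apply/(measurable_restrictT _ (measurable_itv _)).
move=> s _; rewrite patchE; case: ifPn => [|/negP].
  rewrite inE => sT; under eq_integral do rewrite (congr1 (@^~ _) (HE sT)).
  apply: (@le_trans _ _ (\int[P]_x (`|M|%R)%:E)%E); last first.
    rewrite integral_cst// [X in (_ * X)%E](_ : _ = 1%E) ?mule1//; exact: probability_setT.
  apply: ge0_le_integral => //.
  - apply: measurableT_comp => //; apply/measurable_EFinP.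
    exact: (measurableT_comp mh (measurable_pair1 s)).
  - by move=> x _; rewrite lee_fin (le_trans (hM _ _))// ler_norm.
rewrite inE => sT; under eq_integral do rewrite (congr1 (@^~ _) (HN sT)) abse0.
by rewrite integral0.
Qed.

Let GE x : fubini_G mu H x = (\int[mu]_(s in `[0%R, T]) (h s x)%:E)%E.
Proof.
rewrite /fubini_G [RHS]integral_mkcond; apply: eq_integral => s _.
rewrite patchE; case: ifPn => [|/negP]; rewrite inE => sT.
  by rewrite -(congr1 (@^~ x) (HE sT)).
by rewrite (congr1 (@^~ x) (HN sT)).
Qed.

Let FE : fubini_F P H = ((fun s => \int[P]_x (h s x)%:E) \_ `[0%R, T])%E.
Proof.
apply/funext => s; rewrite /fubini_F patchE.
case: ifPn => [|/negP]; rewrite inE => sT.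
  by rewrite (HE sT).
by rewrite (HN sT) integral0.
Qed.

Lemma bounded_fubini_measurable :
  measurable_fun setT (fun x => \int[mu]_(s in `[0%R, T]) (h s x)%:E)%E.
Proof. by rewrite -(funext GE); exact: (measurable_fubini_G iH). Qed.

Lemma bounded_fubini_integrable :
  mu.-integrable `[0, T] (fun s => \int[P]_x (h s x)%:E)%E.
Proof.
have : mu.-integrable setT (fubini_F P H) by exact: (integrable_fubini_F iH).
rewrite FE => /integrable_restrict.
by rewrite setTI; apply.
Qed.

Lemma bounded_fubini :
  (\int[P]_x \int[mu]_(s in `[0%R, T]) (h s x)%:E =
   \int[mu]_(s in `[0%R, T]) \int[P]_x (h s x)%:E)%E.
Proof.
rewrite [RHS]integral_mkcond -FE; have := Fubini iH; rewrite /fubini_F => ->.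
by apply: eq_integral => x _; rewrite -GE.
Qed.

End bounded_fubini.

(** * Finite costs and their decomposition *)

(** The negative part of [l + phi] is bounded, so an integral below [+oo] forces the positive part
    to be integrable too. The bounded term [phi] is then subtracted. *)
Lemma integrable_of_perturbation (d : measure_display) (X : measurableType d) (R : realType)
    (mu : {measure set X -> \bar R}) (D : set X) (l phi : X -> R) (c M : R) :
  measurable D -> (mu D < +oo)%E -> measurable_fun D l -> measurable_fun D phi ->
  (forall x, D x -> c <= l x) -> (forall x, D x -> `|phi x| <= M) ->
  (\int[mu]_(x in D) (l x + phi x)%:E < +oo)%E ->
  mu.-integrable D (EFin \o l).
Proof.
move=> mD muD ml mphi lc phiM kfin.
pose k : X -> \bar R := fun x => (l x + phi x)%:E.
have mk : measurable_fun D k by apply/measurable_EFinP; exact: measurable_funD.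
have ineg : mu.-integrable D (k^\-)%E.
  apply: (@le_integrable _ _ _ mu _ mD _ (EFin \o cst (`|c| + M))).
  - exact: measurable_funeneg.
  - move=> x Dx /=; rewrite funenegE /k -EFinN gee0_abs; last by rewrite le_max lexx orbT.
    have h0 : 0 <= `|c| + M by rewrite addr_ge0// (le_trans _ (phiM _ Dx)).
    rewrite ger0_norm// ge_max !lee_fin h0 andbT.
    have := lc x Dx; have := phiM x Dx; rewrite ler_norml => /andP[? ?].
    by have := ler_norm (- c); rewrite normrN; lra.
  - by apply: (@bounded_integrable _ _ _ _ _ _ `| `|c| + M|).
have ipos : mu.-integrable D (k^\+)%E.
  apply/integrableP; split; first exact: measurable_funepos.
  under eq_integral do rewrite gee0_abs ?funepos_ge0//.
  move: kfin; rewrite -[X in (X < _)%E -> _]/(\int[mu]_(x in D) k x)%E integralE.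
  have := integrable_fin_num mD ineg.
  case: (\int[mu]_(x in D) k^\- x)%E => [r _||]//.
  by case: (\int[mu]_(x in D) k^\+ x)%E => [r'||]; rewrite ?ltry// addye// ltxx.
have ik : mu.-integrable D k by rewrite [k]funeposneg; exact: integrableB.
have iphi : mu.-integrable D (EFin \o phi) by exact: (@bounded_integrable _ _ _ _ _ _ M).
apply: (@eq_integrable _ _ _ mu D mD (k \- (EFin \o phi))%E).
  by move=> x _ /=; rewrite /k -EFinB addrK.
exact: integrableB.
Qed.

Lemma Gamma_cst (R : realType) (n : nat) (T : R) (Om : set 'rV[R]_n) x :
  closure Om x -> Gamma T Om (fun=> x).
Proof.
move=> Ox; split => // e e0; exists 1 => // k a b _ _ _.
by rewrite big1// => i _; rewrite subrr normr0.
Qed.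

Section cost_decomposition.
Context {R : realType} {n : nat} (T : R) (Om : set 'rV[R]_n).
Local Notation V := 'rV[R]_n.
Local Notation mu := (@lebesgue_measure R).
Hypothesis T0 : 0 < T.
Hypothesis bOm : bounded_set Om.
Variables (L : V -> V -> R) (F G : V -> probability (borelRn R n) R -> R).
Hypotheses (cL : cont_OmV Om L) (lL : L2 Om L) (cF : cont_OmP Om F).
Variable eta : probability (cspace n T) R.
Hypothesis oG : on_Gamma Om eta.
Variable m : R -> probability (borelRn R n) R.
Hypothesis fm : is_flow eta m.

(** Joint continuity in time and space on the compact product of [[0, T]] with the closure of
    [Om]. *)
Lemma flow_coef_bounded : exists M, forall s x, 0 <= s <= T -> closure Om x ->
  `|F x (m s)| <= M.
Proof.
have [B [mB BG B1]] := oG.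
have cpt : compact (`[0, T]%classic `*` closure Om).
  by apply: compact_setX; [exact: segment_compact|exact: closure_compact].
have [M FM] := eps_cont_on_bounded cpt (flow_eps_cont bOm mB BG B1 cF fm).
by exists M => s x sT Ox; apply: (FM (s, x)); split => //=; rewrite in_itv.
Qed.

Lemma flow_coef_continuous g : Gamma T Om g ->
  continuous (fun s => F (g (clamp T s)) (m (clamp T s))).
Proof.
have [B [mB BG B1]] := oG => Gg s; apply/cvgrPdist_lt => e e0.
have cT t : 0 <= clamp T t <= T by rewrite clamp_itv ?ltW.
have inC t : (`[0, T]%classic `*` closure Om) (clamp T t, g (clamp T t)).
  by split => /=; [rewrite in_itv/= cT|case: Gg => _; apply].
have [d d0 Fd] := flow_eps_cont bOm mB BG B1 cF fm (inC s) e0.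
have /cvgrPdist_lt /(_ _ d0) gd := @Gamma_clamp_continuous _ _ _ T0 _ _ Gg s.
near=> t; rewrite distrC; apply: (Fd _ (inC t)).
rewrite [X in X < _]/Num.norm/= gt_max; apply/andP; split; rewrite distrC.
  by rewrite (le_lt_trans (clamp_dist _ _ _))//; near: t; exact: (cvgr_dist_lt (cvg_id s)).
by near: t.
Unshelve. all: by end_near.
Qed.

Lemma flow_coef_measurable g : Gamma T Om g ->
  measurable_fun `[0, T] (fun s => F (g s) (m s)).
Proof.
move=> Gg; apply: (@eq_measurable_fun _ _ _ _ _ (fun s => F (g (clamp T s)) (m (clamp T s)))).
  by move=> s; rewrite inE/= in_itv/= => sT; rewrite clamp_id.
by apply: measurable_funTS; apply: continuous_measurable_fun; exact: flow_coef_continuous.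
Qed.

Lemma flow_coef_integrable g : Gamma T Om g ->
  mu.-integrable `[0, T] (fun s => (F (g s) (m s))%:E).
Proof.
move=> Gg; have [M FM] := flow_coef_bounded.
apply: (@bounded_integrable _ _ _ mu _ (fun s => F (g s) (m s)) M) => //.
- exact: lebesgue_itv_lty.
- exact: flow_coef_measurable.
- by move=> s /=; rewrite in_itv/= => sT; apply: FM => //; case: Gg => _; exact.
Qed.

(** The coercivity bound [L2] supplies the lower bound [- c0] on the Lagrangian, and the term in [F]
    is a bounded perturbation. *)
Lemma lagrangian_integrable g : Gamma T Om g -> (J T L F G m g < +oo)%E ->
  mu.-integrable `[0, T] (fun s => (L (g s) (derive1 g s))%:E).
Proof.
move=> Gg; rewrite /J /cost => fin.
have [M FM] := flow_coef_bounded.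
have [c1 [c0 [c10 _ LL]]] := lL.
apply: (@integrable_of_perturbation _ _ _ mu _ (fun s => L (g s) (derive1 g s))
  (fun s => F (g s) (m s)) (- c0) M) => //.
- exact: lebesgue_itv_lty.
- exact: Gamma_lagrangian_measurable cL Gg.
- exact: flow_coef_measurable.
- move=> s /=; rewrite in_itv/= => sT; have [_ /(_ _ sT) Og] := Gg.
  apply: le_trans (LL _ _ Og); rewrite -[leLHS]add0r lerD2r mulr_ge0// ?exprn_ge0//.
  exact: ltW.
- by move=> s /=; rewrite in_itv/= => sT; apply: FM => //; case: Gg => _; exact.
- by move: fin; case: (integral _ _ _) => [r||]; rewrite ?ltry// addye// ltxx.
Qed.

Lemma costE g : Gamma T Om g ->
  mu.-integrable `[0, T] (fun s => (L (g s) (derive1 g s))%:E) ->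
  J T L F G m g = (\int[mu]_(s in `[0, T]) L (g s) (derive1 g s)
    + \int[mu]_(s in `[0, T]) F (g s) (m s) + G (g T) (m T))%:E.
Proof.
move=> Gg iL; rewrite /J /cost EFinD EFinD; congr (_ + _)%E.
have iF := flow_coef_integrable Gg.
rewrite /Rintegral !fineK; try exact: integrable_fin_num.
by rewrite -integralD.
Qed.

(** Resting at the starting point is the competitor that shows every minimal cost to be below
    [+oo]. *)
Lemma cost_cst_lty x : closure Om x -> (J T L F G m (fun=> x) < +oo)%E.
Proof.
move=> Ox; have Gx := Gamma_cst T Ox.
rewrite costE ?ltry//; apply: (@bounded_integrable _ _ _ mu _ _ `|L x 0|) => //.
- exact: lebesgue_itv_lty.
- exact: Gamma_lagrangian_measurable cL Gx.
- by move=> s _; rewrite derive1_cst.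
Qed.

End cost_decomposition.

Lemma probability_setU_full d (X : measurableType d) (R : realType)
    (P : probability X R) (A B : set X) :
  measurable A -> measurable B -> P A = 1%E -> P (A `|` B) = 1%E.
Proof.
move=> mA mB A1; apply/eqP; rewrite eq_le probability_le1/=; last exact: measurableU.
by rewrite -A1 le_measure ?inE//; exact: measurableU.
Qed.

(** A nonzero value persists on a nondegenerate interval inside [[0, T]], which has positive measure
    and so cannot lie in a null set. *)
Lemma ae_eq_itv_eps_cont (R : realType) (T : R) (f : R -> R) : 0 < T ->
  {ae @lebesgue_measure R, forall s, `[0, T]%classic s -> f s = 0} ->
  eps_cont_on `[0, T]%classic f -> forall s, `[0, T]%classic s -> f s = 0.
Proof.
move=> T0 [N [mN N0 subN]] cf s sT; apply: contrapT => /eqP fs.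
have [|d d0 fd] := cf s sT `|f s|; first by rewrite normr_gt0.
move: (sT); rewrite /= in_itv/= => /andP[s0 sT'].
pose a := Num.max 0 (s - d / 2); pose b := Num.min T (s + d / 2).
have ab : a < b.
  by rewrite /a /b gt_max !lt_min T0/=; apply/and3P; split; lra.
have itvN : `[a, b]%classic `<=` N.
  move=> t /=; rewrite in_itv/= /a /b ge_max le_min => /andP[/andP[t0 st] /andP[tT ts]].
  have tT' : `[0, T]%classic t by rewrite /= in_itv/= t0.
  apply: subN => /= /(_ tT') ft0.
  have /(fd _ tT') : `|t - s| < d by rewrite ltr_norml; lra.
  by rewrite ft0 sub0r normrN ltxx.
have : (lebesgue_measure `[a, b]%classic <= lebesgue_measure N)%E.
  by apply: le_measure; rewrite ?inE.
by rewrite N0 lebesgue_measure_itv/= lte_fin ab lee_fin subr_le0 leNgt ab.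
Qed.

(** * Uniqueness of the coupling terms along equilibrium flows *)

Section uniqueness.
Context {R : realType} {n : nat} (T : R) (Om : set 'rV[R]_n).
Local Notation V := 'rV[R]_n.
Local Notation mu := (@lebesgue_measure R).
Hypothesis T0 : 0 < T.
Hypothesis bOm : bounded_set Om.
Variable m0 : probability (borelRn R n) R.
Variables (L : V -> V -> R) (F G : V -> probability (borelRn R n) R -> R).
Hypotheses (cL : cont_OmV Om L) (lL : L2 Om L).
Hypotheses (cF : cont_OmP Om F) (cG : cont_OmP Om G).
Hypotheses (sF : strictly_monotone Om F) (sG : strictly_monotone Om G).

Lemma flow_coef_unique (H : V -> probability (borelRn R n) R -> R)
    (eta : probability (cspace n T) R) m m' s x :
  cont_OmP Om H -> on_Gamma Om eta -> is_flow eta m -> is_flow eta m' ->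
  0 <= s <= T -> closure Om x -> H x (m s) = H x (m' s).
Proof.
move=> cH [B [mB BG B1]] fm fm' sT Ox; apply: (cont_OmP_eq_measure cH) => //.
- exact: (flow_Pbar mB BG B1 fm).
- exact: (flow_Pbar mB BG B1 fm').
- by move=> A mA; rewrite fm// fm'.
Qed.

Lemma cost_congr m m' t g : 0 <= t -> Gamma T Om g ->
  (forall s x, 0 <= s <= T -> closure Om x -> F x (m s) = F x (m' s)) ->
  (forall x, closure Om x -> G x (m T) = G x (m' T)) ->
  cost T L F G m t g = cost T L F G m' t g.
Proof.
move=> t0 [_ gOm] FE GE; rewrite /cost; congr (_ + _)%E; last first.
  by rewrite GE//; apply: gOm; rewrite lexx ltW.
apply: eq_integral => s; rewrite inE/= in_itv/= => /andP[ts sT].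
have sT' : 0 <= s <= T by rewrite sT (le_trans t0).
by rewrite (FE s (g s))//; exact: gOm.
Qed.

Section two_equilibria.
Variables (eta1 eta2 : probability (cspace n T) R) (m1 m2 : R -> probability (borelRn R n) R).
Hypotheses (P1 : P_m0 Om m0 eta1) (P2 : P_m0 Om m0 eta2).
Hypotheses (f1 : is_flow eta1 m1) (f2 : is_flow eta2 m2).
Hypothesis opt1 : forall g, supp Om eta1 g -> forall h, Gamma T Om h -> h 0 = g 0 ->
  (J T L F G m1 g <= J T L F G m1 h)%E.
Hypothesis opt2 : forall g, supp Om eta2 g -> forall h, Gamma T Om h -> h 0 = g 0 ->
  (J T L F G m2 g <= J T L F G m2 h)%E.

Let oG1 : on_Gamma Om eta1. Proof. by case: P1. Qed.
Let oG2 : on_Gamma Om eta2. Proof. by case: P2. Qed.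

Let Phi m g : R := \int[mu]_(s in `[0, T]) F (g s) (m s) + G (g T) (m T).

Lemma cost_gap_le g1 g2 : supp Om eta1 g1 -> supp Om eta2 g2 -> g1 0 = g2 0 ->
  Phi m1 g1 - Phi m2 g1 <= Phi m1 g2 - Phi m2 g2.
Proof.
move=> S1 S2 g12; have [Gg1 _] := S1; have [Gg2 _] := S2.
have Og0 : closure Om (g1 0) by case: Gg1 => _; apply; rewrite lexx ltW.
(* Both Lagrangian terms must be finite before they can be cancelled; each optimal path is compared
   with the constant path. *)
have iL1 := lagrangian_integrable T0 bOm cL lL cF oG1 f1 Gg1
  (le_lt_trans (opt1 S1 (Gamma_cst T Og0) erefl) (cost_cst_lty T0 bOm G cL cF oG1 f1 Og0)).
have iL2 := lagrangian_integrable T0 bOm cL lL cF oG2 f2 Gg2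
  (le_lt_trans (opt2 S2 (Gamma_cst T Og0) g12) (cost_cst_lty T0 bOm G cL cF oG2 f2 Og0)).
have := opt1 S1 Gg2 (esym g12); have := opt2 S2 Gg1 g12.
rewrite !(costE T0 bOm G cF oG1 f1)// !(costE T0 bOm G cF oG2 f2)// !lee_fin /Phi.
lra.
Qed.

Let f s x := F x (m1 s) - F x (m2 s).
Let k x := G x (m1 T) - G x (m2 T).

Let TT : 0 <= T <= T. Proof. by rewrite lexx ltW. Qed.

Let gap_eps_cont (H : V -> probability (borelRn R n) R -> R) : cont_OmP Om H ->
  eps_cont_on (`[0, T] `*` closure Om) (fun p : R * V => H p.2 (m1 p.1) - H p.2 (m2 p.1)).
Proof.
have [B1 [mB1 BG1 B11]] := oG1; have [B2 [mB2 BG2 B21]] := oG2.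
move=> cH p Cp e e0; have e20 : 0 < e / 2 by rewrite divr_gt0.
have [a a0 Ha] := flow_eps_cont bOm mB1 BG1 B11 cH f1 Cp e20.
have [b b0 Hb] := flow_eps_cont bOm mB2 BG2 B21 cH f2 Cp e20.
exists (Num.min a b); first by rewrite lt_min a0.
move=> q Cq; rewrite lt_min => /andP[/(Ha _ Cq) h1 /(Hb _ Cq) h2].
rewrite opprD addrACA -opprD (le_lt_trans (ler_normB _ _))//.
by rewrite (splitr e) ltrD.
Qed.

Let gap_eps_cont_x (H : V -> probability (borelRn R n) R -> R) s : cont_OmP Om H ->
  0 <= s <= T -> eps_cont_on (closure Om) (fun x => H x (m1 s) - H x (m2 s)).
Proof.
move=> cH sT x Ox e e0.
have [|d d0 hd] := gap_eps_cont cH (x := (s, x)) _ e0; first by split => //=; rewrite in_itv.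
exists d => // y Oy yx; apply: (hd (s, y)); first by split => //=; rewrite in_itv.
have ss : `|s - s| < d by rewrite subrr normr0.
by rewrite [X in X < _]/Num.norm/= gt_max; apply/andP.
Qed.

Let gap_eps_cont_s x : closure Om x -> eps_cont_on `[0, T]%classic (f^~ x).
Proof.
move=> Ox s sT e e0.
have [|d d0 hd] := gap_eps_cont cF (x := (s, x)) _ e0; first by split.
exists d => // t tT st; apply: (hd (t, x)); first by split.
have xx : `|x - x| < d by rewrite subrr normr0.
by rewrite [X in X < _]/Num.norm/= gt_max; apply/andP.
Qed.

Lemma optimal_flows_coef_unique :
  (forall s x, 0 <= s <= T -> closure Om x -> F x (m1 s) = F x (m2 s)) /\
  (forall x, closure Om x -> G x (m1 T) = G x (m2 T)).
Proof.
have [S1 [mS1 S1s S11]] := supp_full oG1.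
have [S2 [mS2 S2s S21]] := supp_full oG2.
(* A single carrier of full measure for both equilibria, so that the gap is one function integrated
   against two measures. *)
pose B := S1 `|` S2.
have mB : measurable B by exact: measurableU.
have BG : B `<=` Gamma T Om by move=> g [/S1s[]|/S2s[]].
have B1 : eta1 B = 1%E by exact: probability_setU_full.
have B2 : eta2 B = 1%E by rewrite /B setUC; exact: probability_setU_full.
have cT s : 0 <= clamp T s <= T by rewrite clamp_itv ?ltW.
(* The clamped time and the cut-off outside [B] make the integrand continuous in time on the whole
   line and measurable in the path. *)
pose h s : cspace n T -> R := (fun g => f (clamp T s) (g (clamp T s))) \_ B.
pose kT : cspace n T -> R := (fun g => k (g T)) \_ B.
have mh s : measurable_fun setT (h s).
  apply/(measurable_restrictT _ mB).
  apply: (measurable_eval_comp BG (f := f (clamp T s))) => //.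
  exact: gap_eps_cont_x.
have mk : measurable_fun setT kT.
  apply/(measurable_restrictT _ mB).
  apply: (measurable_eval_comp BG (f := k)) => //.
  exact: gap_eps_cont_x.
have ch g : continuous (h ^~ g).
  have [Bg|nBg] := pselect (B g); last first.
    rewrite (_ : h^~ g = cst 0); first by move=> s; exact: cvg_cst.
    by apply/funext => s; rewrite /h patchE ifF//; apply/negP; rewrite inE.
  rewrite (_ : h^~ g = fun s => f (clamp T s) (g (clamp T s))).
    move=> s; apply: cvgB.
    - exact: (flow_coef_continuous T0 bOm cF oG1 f1 (BG _ Bg)).
    - exact: (flow_coef_continuous T0 bOm cF oG2 f2 (BG _ Bg)).
  by apply/funext => s; rewrite /h patchE ifT// inE.
have [M1 FM1] := flow_coef_bounded bOm cF oG1 f1.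
have [M2 FM2] := flow_coef_bounded bOm cF oG2 f2.
have [N1 GN1] := flow_coef_bounded bOm cG oG1 f1.
have [N2 GN2] := flow_coef_bounded bOm cG oG2 f2.
have hM s g : `|h s g| <= `|M1 + M2|.
  rewrite /h patchE; case: ifPn; last by rewrite normr0.
  rewrite inE => /BG[_ gOm]; apply: le_trans (ler_norm _).
  by rewrite (le_trans (ler_normB _ _))//; apply: lerD; [apply: FM1|apply: FM2] => //; exact: gOm.
have kM g : `|kT g| <= `|N1 + N2|.
  rewrite /kT patchE; case: ifPn; last by rewrite normr0.
  rewrite inE => /BG[_ gOm]; apply: le_trans (ler_norm _).
  by rewrite (le_trans (ler_normB _ _))//; apply: lerD; [apply: GN1|apply: GN2] => //; exact: gOm.
have mhh := measurable_continuous_uncurry mh ch.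
pose D0 g : R := \int[mu]_(s in `[0, T]) h s g.
have ihs g : mu.-integrable `[0, T] (fun s => (h s g)%:E).
  apply: (@bounded_integrable _ _ _ mu _ (h^~ g) `|M1 + M2|) => //.
    exact: lebesgue_itv_lty.
  by apply: measurable_funTS; exact: continuous_measurable_fun.
have D0E g : (D0 g)%:E = (\int[mu]_(s in `[0%R, T]) (h s g)%:E)%E.
  by rewrite /D0 /Rintegral fineK//; exact: integrable_fin_num.
pose D g := D0 g + kT g.
have mD0 : measurable_fun setT D0.
  apply/measurable_EFinP; rewrite (_ : EFin \o D0 = (fun g => \int[mu]_(s in `[0%R, T]) (h s g)%:E)%E).
    exact: (bounded_fubini_measurable eta1 T mhh hM).
  by apply/funext => g; exact: D0E.
pose muT := fine (mu `[0, T]%classic).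
have D0M g : `|D0 g| <= `|M1 + M2| * muT.
  apply: (le_trans (le_normr_Rintegral _ (ihs g))) => //.
  rewrite -(Rintegral_cst mu)//; apply: le_Rintegral => //.
  - apply: (@bounded_integrable _ _ _ mu _ (fun s => `|h s g|) `|M1 + M2|) => //.
    + exact: lebesgue_itv_lty.
    + by apply: measurableT_comp => //; apply: measurable_funTS; exact: continuous_measurable_fun.
    + by move=> s _; rewrite normr_id.
  - apply: (@bounded_integrable _ _ _ mu _ (cst `|M1 + M2|) `|M1 + M2|) => //.
      exact: lebesgue_itv_lty.
    by move=> s _ /=; rewrite normr_id.
have DE g : B g -> D g = Phi m1 g - Phi m2 g.
  move=> Bg; have Gg := BG _ Bg.
  rewrite /D /D0 /Phi opprD addrACA -RintegralB//.
  - congr (_ + _); last by rewrite /kT patchE ifT// inE.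
    apply: eq_Rintegral => s; rewrite inE/= in_itv/= => sT.
    by rewrite /h patchE ifT ?inE// clamp_id.
  - exact: (flow_coef_integrable T0 bOm cF oG1 f1).
  - exact: (flow_coef_integrable T0 bOm cF oG2 f2).
(* The only use of optimality: [cost_gap_le] feeds the comparison of tails, which is then
   integrated. *)
have intD : (\int[eta1]_g (D g)%:E <= \int[eta2]_g (D g)%:E)%E.
  apply: (@le_integral_of_tails _ _ _ _ _ _ (`|M1 + M2| * muT + `|N1 + N2|)).
  - exact: measurable_funD.
  - by move=> g; rewrite (le_trans (ler_normD _ _))// lerD.
  move=> s; apply: (@tail_dominated _ _ _ Om eta1 eta2 m0 S1 S2 D s (ltW T0)) => //.
  - by move=> g /S1s[[]].
  - exact: measurable_funD.
  - move=> g1 g2 Sg1 Sg2 g12; rewrite !DE; [|by right|by left].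
    by apply: cost_gap_le => //; [exact: S1s|exact: S2s].
pose I (eta : probability (cspace n T) R) s := (\int[eta]_g (h s g)%:E)%E.
pose K (eta : probability (cspace n T) R) := (\int[eta]_g (kT g)%:E)%E.
have setT_lty (eta : probability (cspace n T) R) : (eta setT < +oo)%E.
  by rewrite (le_lt_trans (probability_le1 _ _)) ?ltry.
have ikT (eta : probability (cspace n T) R) : eta.-integrable setT (EFin \o kT).
  by apply: (@bounded_integrable _ _ _ eta _ kT `|N1 + N2|) => //; exact: setT_lty.
have iI (eta : probability (cspace n T) R) : mu.-integrable `[0, T] (I eta).
  exact: (bounded_fubini_integrable eta T mhh hM).
have intDE (eta : probability (cspace n T) R) :
    (\int[eta]_g (D g)%:E = \int[mu]_(s in `[0%R, T]) I eta s + K eta)%E.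
  under eq_integral do rewrite EFinD.
  have iD0 : eta.-integrable setT (EFin \o D0).
    by apply: (@bounded_integrable _ _ _ eta _ D0 (`|M1 + M2| * muT)) => //; exact: setT_lty.
  rewrite (integralD _ iD0 (ikT eta))//.
  congr (_ + _)%E; rewrite -(bounded_fubini eta T mhh hM).
  by apply: eq_integral => g _; exact: D0E.
have IE (eta : probability (cspace n T) R) m s : eta B = 1%E -> is_flow eta m -> 0 <= s <= T ->
    I eta s = (\int[m s]_(x in closure Om) (f s x)%:E)%E.
  move=> Beta fm sT; rewrite (flow_integral bOm mB BG Beta fm _ sT); last exact: gap_eps_cont_x.
  rewrite [RHS]integral_mkcond; apply: eq_integral => g _.
  by rewrite /h !patchE clamp_id//; case: ifPn.
have KE (eta : probability (cspace n T) R) m : eta B = 1%E -> is_flow eta m ->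
    K eta = (\int[m T]_(x in closure Om) (k x)%:E)%E.
  move=> Beta fm; rewrite (flow_integral bOm mB BG Beta fm _ TT); last exact: gap_eps_cont_x.
  rewrite [RHS]integral_mkcond; apply: eq_integral => g _.
  by rewrite /kT !patchE; case: ifPn.
have Ifin (eta : probability (cspace n T) R) s : I eta s \is a fin_num.
  apply: integrable_fin_num => //.
  by apply: (@bounded_integrable _ _ _ eta _ (h s) `|M1 + M2|) => //; exact: setT_lty.
have Kfin (eta : probability (cspace n T) R) : K eta \is a fin_num.
  by apply: integrable_fin_num => //; exact: ikT.
have Afin (eta : probability (cspace n T) R) : (\int[mu]_(s in `[0%R, T]) I eta s)%E \is a fin_num.
  by apply: integrable_fin_num => //; exact: iI.
have Pb1 s : 0 <= s <= T -> Pbar Om (m1 s) by exact: (flow_Pbar mB BG B1 f1).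
have Pb2 s : 0 <= s <= T -> Pbar Om (m2 s) by exact: (flow_Pbar mB BG B2 f2).
(* Monotonicity gives the inequalities opposite to [intD], for each time in the term of [F] and at
   [T] in the term of [G]. *)
have I21 s : 0 <= s <= T -> (I eta2 s <= I eta1 s)%E.
  move=> sT; rewrite -sube_ge0 ?Ifin// (IE _ _ _ B1 f1)// (IE _ _ _ B2 f2)//.
  by have [] := sF (Pb1 s sT) (Pb2 s sT).
have K21 : (K eta2 <= K eta1)%E.
  rewrite -sube_ge0 ?Kfin// (KE _ _ B1 f1) (KE _ _ B2 f2).
  by have [] := sG (Pb1 T TT) (Pb2 T TT).
have A21 : (\int[mu]_(s in `[0%R, T]) I eta2 s <= \int[mu]_(s in `[0%R, T]) I eta1 s)%E.
  by apply: le_integral => // s; rewrite inE/= in_itv/= => sT; exact: I21.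
(* The sum is ordered one way and each of its two terms the other way; all four numbers being
   finite, both terms agree. *)
have [A12 K12] : (\int[mu]_(s in `[0%R, T]) I eta1 s = \int[mu]_(s in `[0%R, T]) I eta2 s)%E
    /\ K eta1 = K eta2.
  move: intD A21 K21; rewrite !intDE.
  rewrite -(fineK (Afin eta1)) -(fineK (Afin eta2)) -(fineK (Kfin eta1)) -(fineK (Kfin eta2)).
  rewrite -!EFinD !lee_fin => ? ? ?; split; congr (_%:E); lra.
split; last first.
  have [_ [+ _]] := sG (Pb1 T TT) (Pb2 T TT); apply.
  by rewrite -(KE _ _ B1 f1) -(KE _ _ B2 f2) K12 subee.
have : ae_eq mu `[0, T]%classic (I eta1 \- I eta2)%E (cst 0%E).
  apply/ae_eq_integral_abs => //.
    by apply: emeasurable_funB; apply: measurable_int; exact: iI.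
  transitivity (\int[mu]_(s in `[0%R, T]) (I eta1 \- I eta2) s)%E; last first.
    by rewrite integralB// A12 subee.
  by apply: eq_integral => s; rewrite inE/= in_itv/= => sT; rewrite gee0_abs// sube_ge0 ?Ifin// I21.
(* The null set of exceptional times does not depend on [x]; for fixed [x] the gap is continuous in
   time, which removes it. *)
move=> aeI s x sT Ox; apply/eqP; rewrite -subr_eq0; apply/eqP.
apply: (ae_eq_itv_eps_cont T0 _ (gap_eps_cont_s Ox)); last by rewrite /= in_itv.
apply: filterS aeI => t It tT; have := It tT; rewrite /= in_itv/= in tT.
rewrite (IE _ _ _ B1 f1)// (IE _ _ _ B2 f2)// => It0.
have [_ [+ _]] := sF (Pb1 t tT) (Pb2 t tT).
by move=> /(_ It0 _ Ox) /eqP; rewrite -subr_eq0 => /eqP.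
Qed.

End two_equilibria.

(** [MFG_equilibrium] provides optimality only for some flow [m'] of [eta]. Any other flow agrees
    with it on measurable sets, so continuity of [F] and [G] makes the two costs equal. *)
Lemma equilibrium_optimal (eta : probability (cspace n T) R) m :
  MFG_equilibrium Om L F G m0 eta -> is_flow eta m ->
  forall g, supp Om eta g -> forall h, Gamma T Om h -> h 0 = g 0 ->
  (J T L F G m g <= J T L F G m h)%E.
Proof.
move=> [[oG _] [m' [fm' opt]]] fm g Sg h Gh hg.
have TT : 0 <= T <= T by rewrite lexx ltW.
have JE p : Gamma T Om p -> J T L F G m p = J T L F G m' p.
  move=> Gp; apply: cost_congr => // [s x sT Ox|x Ox].
  - exact: (flow_coef_unique cF oG).
  - exact: (flow_coef_unique cG oG).
by rewrite !JE//; [exact: opt|case: Sg].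
Qed.

Lemma equilibria_coef_unique (eta1 eta2 : probability (cspace n T) R) m1 m2 :
  MFG_equilibrium Om L F G m0 eta1 -> MFG_equilibrium Om L F G m0 eta2 ->
  is_flow eta1 m1 -> is_flow eta2 m2 ->
  (forall s x, 0 <= s <= T -> closure Om x -> F x (m1 s) = F x (m2 s)) /\
  (forall x, closure Om x -> G x (m1 T) = G x (m2 T)).
Proof.
move=> e1 e2 f1 f2; apply: (@optimal_flows_coef_unique eta1 eta2 m1 m2 _ _ f1 f2); [by case: e1|by case: e2|..].
- exact: (equilibrium_optimal e1 f1).
- exact: (equilibrium_optimal e2 f2).
Qed.
End uniqueness.

Theorem theorem4p1 (R : realType) (n : nat) (Om : set 'rV[R]_n) (T : R)
  (m0 : probability (borelRn R n) R) (L : 'rV[R]_n -> 'rV[R]_n -> R)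
  (F G : 'rV[R]_n -> probability (borelRn R n) R -> R) :
  0 < T -> open Om -> bounded_set Om -> C2_boundary Om ->
  Pbar Om m0 ->
  L1 Om L -> L2 Om L -> L3 Om L ->
  cont_OmP Om F -> cont_OmP Om G ->
  strictly_monotone Om F -> strictly_monotone Om G ->
  (forall eta1 eta2 : probability (cspace n T) R,
     MFG_equilibrium Om L F G m0 eta1 -> MFG_equilibrium Om L F G m0 eta2 ->
     forall m1 m2, is_flow eta1 m1 -> is_flow eta2 m2 ->
     forall g, Gamma T Om g -> J T L F G m1 g = J T L F G m2 g)
  /\
  (forall u1 m1 u2 m2,
     mild_solution T Om L F G m0 u1 m1 -> mild_solution T Om L F G m0 u2 m2 ->
     forall t x, 0 <= t <= T -> closure Om x -> u1 t x = u2 t x).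
Proof.
move=> T0 _ bOm _ _ [_ [_ [_ _ cL _ _]]] lL _ cF cG sF sG; split.
  move=> eta1 eta2 e1 e2 m1 m2 f1 f2 g Gg.
  have [FE GE] := equilibria_coef_unique T0 bOm cL lL cF cG sF sG e1 e2 f1 f2.
  exact: (cost_congr T0 L (lexx 0) Gg FE GE).
move=> u1 m1 u2 m2 [_ _ [eta1 e1 f1] u1E] [_ _ [eta2 e2 f2] u2E] t x tT Ox.
have [FE GE] := equilibria_coef_unique T0 bOm cL lL cF cG sF sG e1 e2 f1 f2.
have /andP[t0 _] := tT.
(* Both values are infima over the same paths, and the costs agree path by path. *)
apply: EFin_inj; rewrite u1E// u2E//; congr ereal_inf.
by apply/seteqP; split => _ [g [Gg gt] <-]; exists g => //;
  rewrite (cost_congr T0 L t0 Gg FE GE).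
Qed.
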